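(* Let $\xi_i$, $1\le i\le n$, be independent random variables with $E\xi_i=0$ and $Ee^{t_n|\xi_i|}<\infty$ for some $t_n>0$ and for each $1\le i\le n$. Assume that $\sum_{i=1}^nE\xi_i^2=1$, and let $W=\sum_{i=1}^n\xi_i$. Then $$\frac{P(W\ge x)}{1-\Phi(x)}=1+O(1)(1+x^3)\gamma e^{4x^3\gamma}$$ for $0\le x\le t_n$, where $\gamma=\sum_{i=1}^nE|\xi_i|^3e^{x|\xi_i|}$.
   Context: $\Phi$ is the standard normal distribution function. $O(1)$ denotes a quantity whose absolute value is bounded by an absolute (universal) constant. Note that $\gamma$ depends on $x$; if $\gamma=\infty$ the assertion is understood to be vacuous. *)

(* Defs.v *)
From HB Require Import structures.
From mathcomp Require Import all_boot all_order all_algebra.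
From mathcomp Require Import all_classical all_reals all_analysis.

Set Implicit Arguments.
Unset Strict Implicit.
Unset Printing Implicit Defensive.

Import Order.TTheory GRing.Theory Num.Theory.
Import numFieldNormedType.Exports.

Local Open Scope classical_set_scope.
Local Open Scope ring_scope.

Definition mutually_independent (R : realType) (d : measure_display)
    (T : measurableType d) (P : probability T R) (n : nat)
    (xi : 'I_n -> {RV P >-> R}) : Prop :=
  forall (J : {set 'I_n}) (B : 'I_n -> set R),
    (forall i, measurable (B i)) ->
    P (\bigcap_(i in [set` J]) (xi i @^-1` B i)) =
      (\prod_(i in J) P (xi i @^-1` B i))%E.

Definition Phi (R : realType) (x : R) : R := fine (normal_prob 0 1 `]-oo, x]).

Definition gamma (R : realType) (d : measure_display)
    (T : measurableType d) (P : probability T R) (n : nat)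
    (xi : 'I_n -> {RV P >-> R}) (x : R) : \bar R :=
  (\sum_(i < n) 'E_P[fun w => (`|xi i w| ^+ 3 * expR (x * `|xi i w|))%R])%E.

(* Main.v *)
Require Import Defs.
From HB Require Import structures.
From mathcomp Require Import all_boot all_order all_algebra.
From mathcomp Require Import all_classical all_reals all_analysis.
From mathcomp Require Import measurable_realfun.
From mathcomp Require Import ring lra.

Import Order.TTheory GRing.Theory Num.Theory.
Import numFieldNormedType.Exports.

Local Open Scope classical_set_scope.
Local Open Scope ring_scope.

(** Write p = 1 - Phi x and W for the sum.  The proof is Stein's method for the
    indicator of [x, oo), carried out under the original law of W (no change of
    measure), with every constant kept proportional to p.

    Let F be the bounded solution of F'(w) - w F(w) = p - 1(w >= x), and D(w)
    = w F(w) + p - 1(w >= x) its derivative.  Taking expectations at W gives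
      P(W >= x) - p = E[W F(W)] - E[D(W)],
    and, since xi_i has mean zero, is independent of the sum W^i of the other
    variables, and the variances v_i add up to 1, the right-hand side is
      sum over i of  E[xi_i (F(W) - F(W^i))] - v_i E[D(W)].
    A Taylor expansion of F at W^i cancels the main terms and leaves two errors.

    - The smooth part is governed by the derivative of w F(w)
      ([id_steinF_lipschitz]).  In absolute value it is at most 300 p H(w), where H
      ([expsum]) is a finite sum of exponentials e^(y w - y^2/2), 0 <= y <= x,
      placed at the integers so as to dominate e^(w^2/2) on [0, x].  Only
      exponential moments of order at most x are then needed; each exponential
      has expectation at most e^(x^3 gamma), and summing at most x + 2 of them with
      weights 1 + y^2 yields the factor 1 + x^3 ([vsum_expsum_le]).

    - The jump of D at x contributes P(|W^i - x| <= |xi_i|).  This is controlled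
      by a concentration inequality with the Gaussian factor e^(-x^2/2)
      ([concentration]), itself proved from Stein's identity with the test
      function [ramp], an exponentially weighted increasing function: its
      increments, multiplied by the summands, are bounded below on the window
      around x by a multiple of
      eta = sum of |xi_j| min(|xi_j|, gamma).  The mean of eta is of order 1,
      and the event that eta is small is absorbed by an exponential moment
      ([small_eta_le]).

    Averaging over xi_i turns these errors into moments E|xi_i|^k e^(x|xi_i|),
    which add up to at most a constant times p (1 + x^3) gamma e^(x^3 gamma)
    ([tail_error_small]).  All this works when gamma and x gamma are at most
    1/64.  Otherwise 1 + x <= 128 (1 + x^3) gamma, and the estimate already
    follows from Chernoff's bound P(W >= x) <= e^(-x^2/2 + x^3 gamma) and the
    lower bound e^(-x^2/2) <= 24 (1 + x) p ([tail_error_large]). *)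

Set Implicit Arguments.
Unset Strict Implicit.
Unset Printing Implicit Defensive.

(** * Mean value inequalities and exponential bounds *)

Section Calculus.
Variable R : realType.
Implicit Types (a b c k s t u w x y : R) (f df : R -> R).

Lemma ler_of_eq a b : a = b -> a <= b.
Proof. by move=> ->. Qed.

Lemma continuous_of_derive f df : (forall w, is_derive w 1 f (df w)) -> continuous f.
Proof.
move=> fdf w; apply: differentiable_continuous; apply/derivable1_diffP.
exact: ex_derive.
Qed.

Lemma mvt_pair f df a b : (forall w, is_derive w 1 f (df w)) ->
  exists2 c, Num.min a b <= c <= Num.max a b & f b - f a = df c * (b - a).
Proof.
move=> fdf.
have cf : forall u v, {within `[u, v], continuous f}.
  by move=> u v; apply: continuous_subspaceT; exact: continuous_of_derive fdf.
have [ab|/ltW ba] := leP a b.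
  have [c + h] := MVT_segment ab (fun w _ => fdf w) (cf _ _).
  by rewrite in_itv /= => cab; exists c.
have [c + h] := MVT_segment ba (fun w _ => fdf w) (cf _ _).
rewrite in_itv /= => cab; exists c => //.
by rewrite -[LHS]opprB h -mulrN opprB.
Qed.

(** Comparing with the slope [c] instead of bounding the derivative alone
    covers both Lipschitz estimates (slope 0) and first-order expansions. *)
Lemma mvt_norm_le f df a b c k : (forall w, is_derive w 1 f (df w)) ->
  (forall w, Num.min a b <= w <= Num.max a b -> `|df w - c| <= k) ->
  `|f b - f a - c * (b - a)| <= k * `|b - a|.
Proof.
move=> fdf fk; have [z zab ->] := mvt_pair a b fdf.
by rewrite -mulrBl normrM ler_wpM2r // fk.
Qed.

Lemma nondecreasing_of_derive f df a b : (forall w, is_derive w 1 f (df w)) ->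
  (forall w, a <= w <= b -> 0 <= df w) -> a <= b -> f a <= f b.
Proof.
move=> fdf d0 ab; have [c] := mvt_pair a b fdf.
rewrite (min_idPl ab) (max_idPr ab) => cab h.
by rewrite -subr_ge0 h mulr_ge0 ?d0 // subr_ge0.
Qed.

(** The remainders are bounded with the exponential of the absolute value,
    without splitting according to the sign: this is the weight in which all
    moments of the summands are measured. *)
Lemma expR_taylor1 s : `|expR s - 1| <= `|s| * expR `|s|.
Proof.
have := @mvt_norm_le expR expR 0 s 0 (expR `|s|) (fun w => is_derive_expR w).
rewrite mul0r !subr0 expR0 mulrC; apply => w /andP[_ ws].
rewrite subr0 ger0_norm ?expR_ge0 // ler_expR (le_trans ws) //.
by rewrite ge_max normr_ge0 ler_norm.
Qed.

Lemma norm_between0 s w : Num.min 0 s <= w <= Num.max 0 s -> `|w| <= `|s|.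
Proof.
have [s0|s0] := leP 0 s => /andP[h1 h2].
  by rewrite !ger0_norm.
by rewrite !ler0_norm ?lerN2 // ltW.
Qed.

Lemma expR_le_1Dmul s : 0 <= s -> expR s <= 1 + s * expR s.
Proof. by move=> s0; have := expR_taylor1 s; rewrite ler_norml ger0_norm //; lra. Qed.

Lemma expR_taylor2 s : `|expR s - 1 - s| <= `|s| ^+ 2 * expR `|s|.
Proof.
have := @mvt_norm_le (fun w => expR w - w) (fun w => expR w - 1) 0 s 0
  (`|s| * expR `|s|).
rewrite mul0r !subr0 expR0.
have -> : expR s - s - 1 = expR s - 1 - s by ring.
have -> : `|s| * expR `|s| * `|s| = `|s| ^+ 2 * expR `|s| by ring.
apply => w /norm_between0 ws.
rewrite subr0 (le_trans (expR_taylor1 w)) // ler_pM ?expR_ge0 //.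
by rewrite ler_expR.
Qed.

Lemma expR_taylor3 s :
  `|expR s - 1 - s - s ^+ 2 / 2| <= `|s| ^+ 3 * expR `|s|.
Proof.
have := @mvt_norm_le (fun w => expR w - w - w ^+ 2 / 2)
  (fun w => expR w - 1 - w) 0 s 0 (`|s| ^+ 2 * expR `|s|).
rewrite mul0r !subr0 expR0 expr0n /= mul0r subr0.
have -> : expR s - s - s ^+ 2 / 2 - 1 = expR s - 1 - s - s ^+ 2 / 2 by ring.
have -> : `|s| ^+ 2 * expR `|s| * `|s| = `|s| ^+ 3 * expR `|s| by ring.
apply => [w|w /norm_between0 ws].
  by apply: is_derive_eq; rewrite /GRing.scale /=; lra.
rewrite subr0 (le_trans (expR_taylor2 w)) // ler_pM ?expR_ge0 ?exprn_ge0 //.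
  by rewrite lerXn2r ?nnegrE.
by rewrite ler_expR.
Qed.

(** From 1 + s <= e^s, because (1 - s + s^2)(1 + s) = 1 + s^3. *)
Lemma expRN_le_quadratic s : 0 <= s -> expR (- s) <= 1 - s + s ^+ 2.
Proof.
move=> s0; rewrite expRN.
have h := expR_ge1Dx s; have h0 := expR_gt0 s.
rewrite -[_^-1]mul1r ler_pdivrMr //.
have q0 : 0 <= 1 - s + s ^+ 2 by nra.
apply: le_trans (ler_wpM2l q0 h).
have -> : (1 - s + s ^+ 2) * (1 + s) = 1 + s ^+ 3 by ring.
by rewrite lerDl exprn_ge0.
Qed.

End Calculus.

(** * The standard normal distribution *)

Section Normal.
Variable R : realType.
Implicit Types (a b c k s t u w x y : R).

(** The reciprocal of the normal density, which solves the homogeneous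
    equation F'(w) = w F(w). *)
Definition idens w : R := Num.sqrt (pi *+ 2) * expR (w ^+ 2 / 2).

Definition dens w : R := (Num.sqrt (pi *+ 2))^-1 * expR (- (w ^+ 2 / 2)).

Lemma densE w : dens w = (idens w)^-1.
Proof. by rewrite /dens /idens invfM expRN. Qed.

Lemma normal_pdf_dens w : normal_pdf 0 1 w = dens w.
Proof.
rewrite normal_pdfE ?oner_eq0 // /normal_peak /normal_fun /dens.
by rewrite expr1n mul1r subr0 mulNr.
Qed.

(** Rough, but it is the only numerical information on pi that is used. *)
Lemma sqrt2pi_bound : 2 <= Num.sqrt (pi *+ 2 : R) <= 3.
Proof.
have p2 := pi_ge2 R; have p4 := pihalf_lt2 R.
have p0 : 0 <= pi *+ 2 :> R by rewrite mulr2n; lra.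
have h := sqr_sqrtr p0; have h0 := sqrtr_ge0 (pi *+ 2 : R).
by rewrite mulr2n in h h0 *; apply/andP; split; nra.
Qed.

Lemma idens_gt0 w : 0 < idens w.
Proof.
have /andP[h _] := sqrt2pi_bound.
rewrite /idens mulr_gt0 ?expR_gt0 //.
by apply: lt_le_trans h.
Qed.

Lemma is_derive_idens w : is_derive w 1 idens (w * idens w).
Proof.
by apply: is_derive_eq; rewrite /idens /GRing.scale /=; field.
Qed.

Lemma dens_gt0 w : 0 < dens w.
Proof. by rewrite densE invr_gt0 idens_gt0. Qed.

Lemma is_derive_dens w : is_derive w 1 dens (- w * dens w).
Proof.
rewrite /dens; move: (Num.sqrt _)^-1 => c.
by apply: is_derive_eq; rewrite /GRing.scale /=; field.
Qed.

Lemma Phi_integral w : Phi w = \int[lebesgue_measure]_(u in `]-oo, w]) normal_pdf 0 1 u.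
Proof. by rewrite /Phi /normal_prob /Rintegral. Qed.

Lemma is_derive_Phi w : is_derive w 1 (@Phi R) (dens w).
Proof.
have i1 : (@lebesgue_measure R).-integrable [set` Interval (-oo)%O (BRight (w + 1))]
    (EFin \o normal_pdf 0 1).
  apply: (@integrableS _ _ _ _ setT) => //.
  exact: integrable_normal_pdf.
have ww1 : w < w + 1 by lra.
have cw : {for w, continuous (normal_pdf 0 1 : R -> R)}.
  by apply: continuous_normal_pdf; rewrite oner_eq0.
have H := continuous_FTC1 ww1 i1 _ cw.
have [|dP vP] := H; first by rewrite ltNyr.
have -> : @Phi R = fun y => \int[lebesgue_measure]_(u in `]-oo, y]) normal_pdf 0 1 u.
  by apply/funext => y; exact: Phi_integral.
apply: DeriveDef => //.
by rewrite -derive1E vP normal_pdf_dens.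
Qed.

Lemma Phi_ge0 w : 0 <= Phi w.
Proof. by rewrite /Phi fine_ge0. Qed.

Let idTR : measurableTypeR R -> R := idfun.

#[local] HB.instance Definition _ :=
  @isMeasurableFun.Build _ _ _ _ idTR (@measurable_id _ _ setT).

Let stdnormal : {RV (normal_prob 0 1 : probability (measurableTypeR R) R) >-> R} := idTR.

Lemma EFin_Phi w : (Phi w)%:E = cdf stdnormal w.
Proof.
rewrite /Phi fineK; last by rewrite fin_num_measure.
by rewrite /cdf /distribution /pushforward preimage_id.
Qed.

Lemma Phi_le1 w : Phi w <= 1.
Proof. by rewrite -lee_fin EFin_Phi cdf_le1. Qed.

Lemma cvg_Phi_y : @Phi R w @[w --> +oo] --> (1 : R).
Proof.
have -> : @Phi R = fine \o cdf stdnormal.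
  by apply/funext => w; rewrite /comp -EFin_Phi.
by apply: fine_cvg; exact: cvg_cdfy1.
Qed.

Lemma cvg_Phi_Ny : @Phi R w @[w --> -oo] --> (0 : R).
Proof.
have -> : @Phi R = fine \o cdf stdnormal.
  by apply/funext => w; rewrite /comp -EFin_Phi.
by apply: fine_cvg; exact: cvg_cdfNy0.
Qed.

Lemma Phi_near1 (e w : R) : 0 < e -> exists2 u, w <= u & 1 - Phi u < e.
Proof.
move=> e0.
have h : \forall u \near +oo, `|1 - @Phi R u| < e.
  by have /cvgrPdist_lt := cvg_Phi_y; apply.
near (pinfty_nbhs R) => u; exists u; first by near: u; apply: nbhs_pinfty_ge; rewrite num_real.
by apply: le_lt_trans (ler_norm _) _; near: u.
Unshelve. all: by end_near. Qed.

(** The sum Phi u + Phi (- u) has derivative zero, since the density is even,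
    and it tends to 1 at infinity. *)
Lemma PhiN w : Phi (- w) = 1 - Phi w.
Proof.
pose f u : R := Phi u + Phi (- u).
have df u : is_derive u 1 f 0.
  have h1 := is_derive_Phi u; have h2 := is_derive_Phi (- u).
  have h3 : is_derive u 1 (fun v => Phi (- v)) (- dens u).
    have h4 : is_derive u 1 (@GRing.opp R) (- 1) by exact: is_deriveN.
    have := @is_derive1_comp _ (@Phi R) (@GRing.opp R) u _ _ h2 h4.
    by rewrite /dens sqrrN mulrN1.
  by apply: is_derive_eq; ring.
have fc u : f u = f w.
  have [c _ /eqP] := mvt_pair w u df.
  by rewrite mul0r subr_eq0 => /eqP.
have f1 : f u @[u --> +oo] --> (1 + 0 : R).
  apply: cvgD; first exact: cvg_Phi_y.
  by have /cvgNy_compNP := cvg_Phi_Ny.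
have fE : f = cst (f w) by apply/funext => u; rewrite fc.
have fw : f w = 1.
  by rewrite fE addr0 in f1; apply: (cvg_unique _ (cvg_cst (f w)) f1).
by rewrite -fw /f; ring.
Qed.

(** The difference of the two sides, divided by [w], increases to a limit that
    is at most zero, so it is nonpositive throughout. *)
Lemma mills_upper w : 0 <= w -> w * (1 - Phi w) <= dens w.
Proof.
rewrite le_eqVlt => /predU1P[<-|w0]; first by rewrite mul0r ltW ?dens_gt0.
pose f u : R := 1 - Phi u - w^-1 * dens u.
have df u : is_derive u 1 f (- dens u + w^-1 * (u * dens u)).
  have h1 := is_derive_Phi u; have h2 := is_derive_dens u.
  by apply: is_derive_eq; rewrite /GRing.scale /=; ring.
rewrite mulrC -ler_pdivlMr // mulrC -subr_le0 -/(f w).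
apply/ler_addgt0Pl => e e0; rewrite addr0.
have [u wu /ltW ue] := Phi_near1 w e0.
apply: le_trans (le_trans _ ue).
  apply: (nondecreasing_of_derive df _ wu) => v /andP[wv _].
  rewrite addrC subr_ge0 mulrA ler_peMl ?(ltW (dens_gt0 _)) //.
  by rewrite mulrC ler_pdivlMr ?mul1r.
by rewrite /f lerBlDr lerDl mulr_ge0 ?invr_ge0 ?(ltW w0) ?(ltW (dens_gt0 _)).
Qed.

Lemma dens_le w : dens w <= 2 / (2 + w ^+ 2).
Proof.
have /andP[c2 _] := sqrt2pi_bound.
have h := expR_ge1Dx (w ^+ 2 / 2).
have h0 : 0 < 2 + w ^+ 2 by nra.
rewrite densE /idens -[_^-1]mul1r ler_pdivrMr ?mulr_gt0 ?expR_gt0 //; last lra.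
rewrite mulrAC ler_pdivlMr // mul1r.
nra.
Qed.

(** The same comparison at infinity as for the upper bound; the derivative of
    the difference is nonnegative precisely by the upper bound. *)
Lemma mills_lower w : 0 <= w -> w * dens w <= (1 + w ^+ 2) * (1 - Phi w).
Proof.
move=> w0.
pose f u : R := u * dens u - (1 + u ^+ 2) * (1 - Phi u).
have df u : is_derive u 1 f (2 * (dens u - u * (1 - Phi u))).
  have h1 := is_derive_Phi u; have h2 := is_derive_dens u.
  by apply: is_derive_eq; rewrite /GRing.scale /=; ring.
rewrite -subr_le0 -/(f w); apply/ler_addgt0Pl => e e0; rewrite addr0.
(* At this point u dens u <= 2 u / (2 + u^2) <= e. *)
pose u := w + 2 / e.
have wu : w <= u by rewrite lerDl divr_ge0 // ltW.
have fu : f u <= e.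
  have du := dens_le u; have d0 := dens_gt0 u; have P1 := Phi_le1 u.
  have u0 : 0 < u by rewrite ltr_wpDl // divr_gt0.
  have ue : 2 <= e * u by rewrite /u mulrDr mulrCA divff ?gt_eqF // mulr1 lerDr mulr_ge0 // ltW.
  apply: (@le_trans _ _ (u * dens u)).
    by rewrite /f lerBlDr lerDl mulr_ge0 ?subr_ge0 // addr_ge0 // sqr_ge0.
  apply: (@le_trans _ _ (u * (2 / (2 + u ^+ 2)))); first by rewrite ler_wpM2l // ltW.
  rewrite mulrA ler_pdivrMr; last nra.
  nra.
apply: le_trans fu; apply: (nondecreasing_of_derive df _ wu) => v /andP[wv _].
by rewrite mulr_ge0 // subr_ge0 mills_upper // (le_trans w0).
Qed.

Lemma expRN_half : 1 / 2 <= expR (- (1 / 2)) :> R.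
Proof. by have := expR_ge1Dx (- (1 / 2) : R); lra. Qed.

(** Mills' inequality covers w >= 1; below 1 the density is bounded below. *)
Lemma tail_le_dens w : 0 <= w -> 1 - Phi w <= 6 * dens w.
Proof.
move=> w0; have d0 := dens_gt0 w; have P1 := Phi_ge0 w; have P2 := Phi_le1 w.
have [w1|w1] := leP 1 w; first by have := mills_upper w0; nra.
apply: (@le_trans _ _ 1); first lra.
have /andP[c2 c3] := sqrt2pi_bound.
have h : expR (- (1 / 2)) <= expR (- (w ^+ 2 / 2)) by rewrite ler_expR; nra.
have h' := le_trans expRN_half h.
rewrite /dens mulrCA mulrC ler_pdivlMr; last lra.
lra.
Qed.

(** On [x, x + 1/(1 + x)] the exponent w^2/2 exceeds x^2/2 by at most 3/2, so
    the mass of this interval alone gives the bound.  Together with Chernoff's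
    inequality it converts factors e^(-x^2/2) into factors 1 - Phi x. *)
Lemma tail_lower_bound x : 0 <= x ->
  expR (- (x ^+ 2 / 2)) <= 24 * (1 + x) * (1 - Phi x).
Proof.
move=> x0; pose h := (1 + x)^-1; have x1 : 0 < 1 + x by lra.
have h0 : 0 < h by rewrite invr_gt0.
have hx : h * (1 + x) = 1 by rewrite mulVf // gt_eqF.
have [c + eqc] := mvt_pair x (x + h) is_derive_Phi.
rewrite (min_idPl _) ?(max_idPr _) ?lerDl ?(ltW h0) // => /andP[xc ch].
have P1 := Phi_le1 (x + h).
have {eqc} dh : dens c * h <= 1 - Phi x by move: eqc; rewrite addrAC subrr add0r => <-; lra.
have dc : dens c <= (1 - Phi x) * (1 + x).
  have -> : dens c = dens c * h * (1 + x) by rewrite -mulrA hx mulr1.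
  by rewrite ler_wpM2r // ltW.
have e1 : expR (- (x ^+ 2 / 2)) * expR (- (1 / 2)) ^+ 3 <= expR (- (c ^+ 2 / 2)).
  rewrite -expRM_natl -expRD ler_expR.
  have h1 : h <= 1 by rewrite invf_le1 //; lra.
  have : c ^+ 2 <= (x + h) ^+ 2 by rewrite lerXn2r ?nnegrE //; lra.
  nra.
have e2 : 1 / 8 <= expR (- (1 / 2)) ^+ 3 :> R.
  have -> : 1 / 8 = (1 / 2) ^+ 3 :> R by field.
  by rewrite lerXn2r ?nnegrE ?expR_ge0 ?expRN_half.
have /andP[c2 c3] := sqrt2pi_bound.
have e3 : expR (- (c ^+ 2 / 2)) <= 3 * dens c.
  rewrite /dens mulrCA ler_pdivlMl; last lra.
  by rewrite ler_wpM2r ?expR_ge0.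
have e4 : expR (- (x ^+ 2 / 2)) * (1 / 8) <= 3 * dens c.
  apply: le_trans e3; apply: le_trans e1.
  by rewrite ler_wpM2l ?expR_ge0.
lra.
Qed.

Lemma Phi_lt1 x : 0 <= x -> 0 < 1 - Phi x.
Proof.
move=> x0; have := tail_lower_bound x0; have := expR_gt0 (- (x ^+ 2 / 2)).
nra.
Qed.

End Normal.

(** * The Stein equation for a normal tail *)

Section Stein.
Variable R : realType.
(* Recorded so that the sign of the constant in the derivative bounds is
   available to closing tactics without unfolding the numeral. *)
Let ge0_300 : 0 <= 300 :> R := ler0n _ _.
Implicit Types (a b c k s t u w x y z : R).

(** A function glued at [x] from two smooth branches is in general not
    differentiable there, but the mean value inequality survives: split the
    segment at [x] and add the two estimates. *)
Lemma piecewise_mvt_norm_le (f f1 f2 df1 df2 : R -> R) x a b c k :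
  (forall w, is_derive w 1 f1 (df1 w)) -> (forall w, is_derive w 1 f2 (df2 w)) ->
  (forall w, w <= x -> f w = f1 w) -> (forall w, x <= w -> f w = f2 w) ->
  (forall w, Num.min a b <= w <= Num.max a b -> w <= x -> `|df1 w - c| <= k) ->
  (forall w, Num.min a b <= w <= Num.max a b -> x <= w -> `|df2 w - c| <= k) ->
  `|f b - f a - c * (b - a)| <= k * `|b - a|.
Proof.
move=> d1 d2 e1 e2.
have main u v : u <= v -> (forall w, u <= w <= v -> w <= x -> `|df1 w - c| <= k) ->
    (forall w, u <= w <= v -> x <= w -> `|df2 w - c| <= k) ->
    `|f v - f u - c * (v - u)| <= k * `|v - u|.
  move=> uv b1 b2.
  have L s t (st : s <= t) (us : u <= s) (tv : t <= v) (tx : t <= x) :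
      `|f t - f s - c * (t - s)| <= k * `|t - s|.
    rewrite !e1 ?(le_trans st) //; apply: (mvt_norm_le d1) => w.
    rewrite (min_idPl st) (max_idPr st) => /andP[sw wt].
    by apply: b1; rewrite ?(le_trans us) ?(le_trans wt) ?(le_trans _ tv).
  have U s t (st : s <= t) (us : u <= s) (tv : t <= v) (xs : x <= s) :
      `|f t - f s - c * (t - s)| <= k * `|t - s|.
    rewrite !e2 ?(le_trans _ st) //; apply: (mvt_norm_le d2) => w.
    rewrite (min_idPl st) (max_idPr st) => /andP[sw wt].
    by apply: b2; rewrite ?(le_trans us) ?(le_trans wt) ?(le_trans xs).
  have [vx|xv] := leP v x; first exact: L.
  have [xu|ux] := leP x u; first exact: U.
  have h1 := L u x (ltW ux) (lexx _) (ltW xv) (lexx _).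
  have h2 := U x v (ltW xv) (ltW ux) (lexx _) (lexx _).
  have -> : f v - f u - c * (v - u) =
     (f v - f x - c * (v - x)) + (f x - f u - c * (x - u)) by ring.
  apply: le_trans (ler_normD _ _) _; apply: le_trans (lerD h2 h1) _.
  rewrite -mulrDr !ger0_norm ?subr_ge0 ?(ltW xv) ?(ltW ux) //.
  by have -> : v - x + (x - u) = v - u by ring.
have [ab|/ltW ba] := leP a b => b1 b2; first exact: main.
have := main b a ba b1 b2.
rewrite [`|b - a|]distrC; have -> : f a - f b - c * (a - b) = - (f b - f a - c * (b - a)) by ring.
by rewrite normrN.
Qed.

(** The exponents j = 0, 1, 2, ... cut off at [x]: no exponential moment of
    order larger than [x] is available. *)
Definition node x (j : nat) : R := Num.min j%:R x.

(** The exponential e^(y w - y^2/2) is tangent to e^(w^2/2) from below at w = y and has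
    expectation 1 under the normal law.  With nodes at distance at most 1, the
    sum dominates (1 + w^2) e^(w^2/2) on [0, x] up to a factor 2, which replaces a
    function without finite expectation by one made of finitely many
    exponential moments. *)
Definition expsum x w : R :=
  \sum_(j < (Num.trunc x).+2)
    (1 + node x j ^+ 2) * expR (node x j * w - node x j ^+ 2 / 2).

Lemma node_bounds x j : 0 <= x -> 0 <= node x j <= x.
Proof. by move=> x0; rewrite /node le_min ler0n x0 ge_min lexx orbT. Qed.

Lemma expsum_term_ge0 x w (j : nat) :
  0 <= (1 + node x j ^+ 2) * expR (node x j * w - node x j ^+ 2 / 2).
Proof. by rewrite mulr_ge0 ?expR_ge0 // addr_ge0 // sqr_ge0. Qed.

Lemma expsum_term_le x w (j : nat) : (j < (Num.trunc x).+2)%N ->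
  (1 + node x j ^+ 2) * expR (node x j * w - node x j ^+ 2 / 2) <= expsum x w.
Proof.
move=> jx; rewrite /expsum (bigD1 (Ordinal jx)) //= lerDl.
by apply: sumr_ge0 => i _; exact: expsum_term_ge0.
Qed.

Lemma expsum_ge1 x w : 0 <= x -> 1 <= expsum x w.
Proof.
move=> x0; have := @expsum_term_le x w 0%N isT.
by rewrite /node (min_idPl x0) mul0r expr0n /= mul0r subr0 addr0 expR0 mulr1.
Qed.

Lemma expsum_shift x w u : 0 <= x ->
  expsum x (w + u) <= expsum x w * expR (x * `|u|).
Proof.
move=> x0; rewrite /expsum mulr_suml; apply: ler_sum => j _.
have /andP[n0 nx] := node_bounds j x0.
rewrite -mulrA -expRD ler_wpM2l ?addr_ge0 ?sqr_ge0 // ler_expR.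
have : node x j * u <= x * `|u|.
  by apply: le_trans (ler_norm _) _; rewrite normrM ger0_norm // ler_wpM2r.
lra.
Qed.

(** Use the first node y above [w]: the exponents w^2/2 and y w - y^2/2 differ by
    (y - w)^2/2 <= 1/2, and e^(1/2) <= 2. *)
Lemma expsum_expR_ge x w : 0 <= w <= x ->
  (1 + w ^+ 2) * expR (w ^+ 2 / 2) <= 2 * expsum x w.
Proof.
move=> /andP[w0 wx].
have /andP[jw wj] := truncn_itv w0.
set j := (Num.trunc w).+1 in wj.
have jx : (j < (Num.trunc x).+2)%N by rewrite ltnS ltnS le_truncn.
apply: le_trans (ler_wpM2l _ (expsum_term_le w jx)) => //.
set y := node x j.
have wy : w <= y by rewrite le_min (ltW wj) wx.
have yw : y <= w + 1.
  by rewrite (@le_trans _ _ j%:R) ?ge_min ?lexx // /j -addn1 natrD lerD2r.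
have e : expR (w ^+ 2 / 2) <= 2 * expR (y * w - y ^+ 2 / 2).
  apply: (@le_trans _ _ (expR (1 / 2) * expR (y * w - y ^+ 2 / 2))).
    by rewrite -expRD ler_expR; nra.
  rewrite ler_wpM2r ?expR_ge0 //.
  have := expRN_half R; rewrite expRN -[(1 / 2)]invf_div divr1 lef_pV2 ?posrE ?expR_gt0 //.
rewrite mulrCA; apply: ler_pM; rewrite ?addr_ge0 ?expR_ge0 ?sqr_ge0 //.
by rewrite lerD2l lerXn2r ?nnegrE // (le_trans w0).
Qed.

Lemma expsum_last_ge x w : 0 <= x ->
  (1 + x ^+ 2) * expR (x * w - x ^+ 2 / 2) <= expsum x w.
Proof.
move=> x0; have := expsum_term_le w (ltnSn (Num.trunc x).+1).
by rewrite /node (min_idPr _) // ltW // truncnS_gt.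
Qed.

(** [steinF x] is the bounded solution F of F'(w) = w F(w) + (1 - Phi x) - 1(x <= w),
    and [steinD x] is the derivative that the equation prescribes.  The two
    branches [steinL] and [steinU] are smooth on the whole line, so that F can
    be differentiated on either side of [x] separately. *)
Definition steinL x w : R := (1 - Phi x) * (Phi w * idens w).
Definition steinU x w : R := Phi x * ((1 - Phi w) * idens w).
Definition steinF x w : R := if w <= x then steinL x w else steinU x w.
Definition steinD x w : R := w * steinF x w + (1 - Phi x) - (x <= w)%R%:R.

Lemma dens_idens w : dens w * idens w = 1.
Proof. by rewrite densE mulVf // gt_eqF // idens_gt0. Qed.

Lemma steinF_lower x w : w <= x -> steinF x w = steinL x w.
Proof. by rewrite /steinF => ->. Qed.

Lemma steinF_upper x w : x <= w -> steinF x w = steinU x w.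
Proof.
rewrite /steinF le_eqVlt => /predU1P[->|xw]; last by rewrite leNgt xw.
by rewrite lexx /steinL /steinU; ring.
Qed.

Lemma is_derive_steinL x w :
  is_derive w 1 (steinL x) ((1 - Phi x) + w * steinL x w).
Proof.
have h1 := is_derive_Phi w; have h2 := is_derive_idens w.
apply: is_derive_eq; rewrite /GRing.scale /= /steinL.
transitivity ((1 - Phi x) * (dens w * idens w) +
  w * ((1 - Phi x) * (Phi w * idens w))); first by ring.
by rewrite dens_idens mulr1.
Qed.

Lemma is_derive_steinU x w :
  is_derive w 1 (steinU x) (- Phi x + w * steinU x w).
Proof.
have h1 := is_derive_Phi w; have h2 := is_derive_idens w.
apply: is_derive_eq; rewrite /GRing.scale /= /steinU.
transitivity (- Phi x * (dens w * idens w) +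
  w * (Phi x * ((1 - Phi w) * idens w))); first by ring.
by rewrite dens_idens mulr1.
Qed.

Lemma is_derive_id_steinL x w : is_derive w 1 (fun u => u * steinL x u)
  ((1 - Phi x) * ((1 + w ^+ 2) * (Phi w * idens w) + w)).
Proof.
have h1 := is_derive_steinL x w.
by apply: is_derive_eq; rewrite /GRing.scale /= /steinL; ring.
Qed.

Lemma is_derive_id_steinU x w : is_derive w 1 (fun u => u * steinU x u)
  (Phi x * ((1 + w ^+ 2) * ((1 - Phi w) * idens w) - w)).
Proof.
have h1 := is_derive_steinU x w.
by apply: is_derive_eq; rewrite /GRing.scale /= /steinU; ring.
Qed.

Lemma tail_ratio_le6 w : 0 <= w -> (1 - Phi w) * idens w <= 6.
Proof.
move=> w0; have := tail_le_dens w0; have h := idens_gt0 w.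
by rewrite -(ler_pM2r h) -mulrA dens_idens mulr1.
Qed.

Lemma tail_ratio_le_inv w : 0 <= w -> w * ((1 - Phi w) * idens w) <= 1.
Proof.
move=> w0; have := mills_upper w0; have h := idens_gt0 w.
by rewrite -(ler_pM2r h) -mulrA dens_idens.
Qed.

Lemma tail_ratio_ge w : 0 <= w ->
  w <= (1 + w ^+ 2) * ((1 - Phi w) * idens w).
Proof.
move=> w0; have := mills_lower w0; have h := idens_gt0 w.
by rewrite -(ler_pM2r h) -mulrA dens_idens mulr1 -mulrA.
Qed.

Lemma idensN w : idens (- w) = idens w.
Proof. by rewrite /idens sqrrN. Qed.

Lemma idens_le u w : `|u| <= `|w| -> idens u <= idens w.
Proof.
move=> uw; have /andP[c2 _] := sqrt2pi_bound R.
rewrite ler_wpM2l ?sqrtr_ge0 // ler_expR ler_pM2r ?invr_gt0 //.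
by rewrite -(real_normK (num_real u)) -(real_normK (num_real w)) lerXn2r ?nnegrE.
Qed.

Lemma tail_ratio_ge0 w : 0 <= (1 - Phi w) * idens w.
Proof. by rewrite mulr_ge0 ?subr_ge0 ?Phi_le1 // ltW ?idens_gt0. Qed.

(** The derivative of w times the Mills ratio q.  It is nonnegative by the lower
    Mills inequality, and q + w (w q - 1) <= q by the upper one. *)
Lemma tail_ratio_deriv_bound w : 0 <= w ->
  `|(1 + w ^+ 2) * ((1 - Phi w) * idens w) - w| <= 6.
Proof.
move=> w0; have h1 := tail_ratio_ge w0; have h2 := tail_ratio_le_inv w0.
have h3 := tail_ratio_le6 w0; have h4 := tail_ratio_ge0 w.
rewrite ger0_norm ?subr_ge0 //; move: h1 h2 h3 h4.
set q := (1 - Phi w) * _; nra.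
Qed.

Lemma PhiNN w : Phi w = 1 - Phi (- w).
Proof. by rewrite PhiN; ring. Qed.

Section Fixed.
Variable x : R.
Hypothesis x0 : 0 <= x.

(** Below [x] the factor 1 - Phi x compensates the growth of [idens], whose
    largest value on [0, x] is taken at [x]; elsewhere the Mills ratio is
    bounded. *)
Lemma steinF_bound w : 0 <= steinF x w <= 6.
Proof.
have p1 := Phi_le1 x; have p0 := Phi_ge0 x.
have w1 := Phi_le1 w; have w0 := Phi_ge0 w; have i0 := idens_gt0 w.
have t6 := tail_ratio_le6 x0.
have [wx|/ltW xw] := leP w x.
  rewrite steinF_lower // /steinL.
  have q0 : 0 <= Phi w * idens w by rewrite mulr_ge0 // ltW.
  rewrite mulr_ge0 ?subr_ge0 //=.
  have [wn|wp] := leP w 0.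
    have := @tail_ratio_le6 (- w); rewrite oppr_ge0 -PhiNN idensN => /(_ wn) h.
    nra.
  apply: le_trans t6; rewrite ler_wpM2l ?subr_ge0 //.
  apply: (@le_trans _ _ (1 * idens w)); first by rewrite ler_wpM2r // ltW.
  by rewrite mul1r idens_le // !ger0_norm // ltW.
rewrite steinF_upper // /steinU.
have h := tail_ratio_ge0 w; have := tail_ratio_le6 (le_trans x0 xw).
rewrite mulr_ge0 //=; nra.
Qed.

Lemma id_steinF_bound w : `|w * steinF x w| <= 1.
Proof.
have p1 := Phi_le1 x; have p0 := Phi_ge0 x.
have w1 := Phi_le1 w; have w0 := Phi_ge0 w; have i0 := idens_gt0 w.
have /andP[F0 _] := steinF_bound w.
rewrite normrM (ger0_norm F0).
have t6 := tail_ratio_le_inv x0.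
have [wx|/ltW xw] := leP w x.
  rewrite steinF_lower // /steinL.
  have q0 : 0 <= Phi w * idens w by rewrite mulr_ge0 // ltW.
  have [wn|wp] := leP w 0.
    rewrite ler0_norm //.
    have := @tail_ratio_le_inv (- w); rewrite oppr_ge0 -PhiNN idensN => /(_ wn) h.
    have h' : 0 <= - w * (Phi w * idens w) by rewrite mulr_ge0 // oppr_ge0.
    rewrite mulrCA; nra.
  rewrite ger0_norm ?(ltW wp) //; apply: le_trans t6; apply: ler_pM => //.
  - exact: ltW.
  - by rewrite mulr_ge0 ?subr_ge0.
  rewrite ler_wpM2l ?subr_ge0 //.
  apply: (@le_trans _ _ (1 * idens w)); first by rewrite ler_wpM2r // ltW.
  by rewrite mul1r idens_le // !ger0_norm // ltW.
rewrite steinF_upper // /steinU ger0_norm ?(le_trans x0) //.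
have h := tail_ratio_ge0 w; have h2 := tail_ratio_le_inv (le_trans x0 xw).
have h' : 0 <= w * ((1 - Phi w) * idens w) by rewrite mulr_ge0 // (le_trans x0).
rewrite mulrCA; nra.
Qed.

Lemma steinD_bound w : `|steinD x w| <= 3.
Proof.
have := id_steinF_bound w; have p1 := Phi_le1 x; have p0 := Phi_ge0 x.
by rewrite /steinD !ler_norml; case: (x <= w) => /=; lra.
Qed.

Lemma id_steinL_deriv_bound w : w <= x ->
  `|(1 - Phi x) * ((1 + w ^+ 2) * (Phi w * idens w) + w)| <=
    300 * (1 - Phi x) * expsum x w.
Proof.
move=> wx; have px : 0 <= 1 - Phi x by rewrite subr_ge0 Phi_le1.
rewrite normrM (ger0_norm px) mulrAC mulrC ler_wpM2r //.
have H1 := expsum_ge1 w x0.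
have [wn|/ltW wp] := leP w 0.
  have := @tail_ratio_deriv_bound (- w).
  rewrite oppr_ge0 -PhiNN idensN sqrrN opprK => /(_ wn) h; lra.
have w1 := Phi_le1 w; have w0 := Phi_ge0 w; have i0 := idens_gt0 w.
rewrite ger0_norm; last by rewrite addr_ge0 // !mulr_ge0 ?addr_ge0 ?sqr_ge0 // ltW.
have h : (1 + w ^+ 2) * expR (w ^+ 2 / 2) <= 2 * expsum x w.
  by apply: expsum_expR_ge; rewrite wp.
have /andP[c2 c3] := sqrt2pi_bound R.
have a : Phi w * idens w <= 3 * expR (w ^+ 2 / 2).
  apply: (@le_trans _ _ (1 * idens w)); first by rewrite ler_wpM2r // ltW.
  by rewrite mul1r ler_wpM2r ?expR_ge0.
have b : (1 + w ^+ 2) * (Phi w * idens w) <= (1 + w ^+ 2) * (3 * expR (w ^+ 2 / 2)).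
  by rewrite ler_wpM2l // addr_ge0 // sqr_ge0.
have e := expR_ge1Dx (w ^+ 2 / 2).
have s0 := sqr_ge0 w.
have e' : 1 + w ^+ 2 <= (1 + w ^+ 2) * expR (w ^+ 2 / 2) by nra.
nra.
Qed.

(** To the right of [x] the derivative is bounded by an absolute constant, but
    the bound has to be proportional to 1 - Phi x.  The node of [expsum] at
    [x] is at least (1 + x^2) e^(x^2/2) there, and multiplied by 1 - Phi x it is
    bounded below by [tail_lower_bound]. *)
Lemma id_steinU_deriv_bound w : x <= w ->
  `|Phi x * ((1 + w ^+ 2) * ((1 - Phi w) * idens w) - w)| <=
    300 * (1 - Phi x) * expsum x w.
Proof.
move=> xw; have p1 := Phi_le1 x; have p0 := Phi_ge0 x.
rewrite normrM (ger0_norm p0).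
have b := tail_ratio_deriv_bound (le_trans x0 xw).
apply: (@le_trans _ _ 6).
  apply: (@le_trans _ _ (1 * 6)); last by rewrite mul1r.
  exact: ler_pM.
have h := expsum_last_ge w x0.
have t := tail_lower_bound x0.
have e0 : 0 < expR (x ^+ 2 / 2) := expR_gt0 _.
have h' : (1 + x ^+ 2) * expR (x ^+ 2 / 2) <= expsum x w.
  apply: le_trans h; rewrite ler_wpM2l ?addr_ge0 ?sqr_ge0 // ler_expR.
  have := ler_wpM2l x0 xw; lra.
have t' : 1 <= 24 * (1 + x) * ((1 - Phi x) * expR (x ^+ 2 / 2)).
  have := ler_wpM2r (ltW e0) t.
  by rewrite -expRD addNr expR0 mulrA.
have h2 : (1 - Phi x) * ((1 + x ^+ 2) * expR (x ^+ 2 / 2)) <= (1 - Phi x) * expsum x w.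
  by rewrite ler_wpM2l ?subr_ge0.
rewrite mulrCA in h2; rewrite -mulrA; move: t' h2.
move: ((1 - Phi x) * expsum x w) => r.
have : 0 <= (1 - Phi x) * expR (x ^+ 2 / 2) by rewrite mulr_ge0 ?expR_ge0 // subr_ge0.
move: (_ * expR _) => q q0 t' h2.
have h3 : (1 + x) * q <= 2 * ((1 + x ^+ 2) * q).
  by rewrite mulrA ler_wpM2r //; nra.
lra.
Qed.

(** [expsum] is evaluated at the base point [w], not at an intermediate one,
    so that [w] and the increment can later be averaged independently. *)
Lemma id_steinF_lipschitz w z :
  `|z * steinF x z - w * steinF x w| <=
    300 * (1 - Phi x) * `|z - w| * (expsum x w * expR (x * `|z - w|)).
Proof.
have px : 0 <= 1 - Phi x by rewrite subr_ge0 Phi_le1.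
have B v : Num.min w z <= v <= Num.max w z ->
    300 * (1 - Phi x) * expsum x v <=
    300 * (1 - Phi x) * (expsum x w * expR (x * `|z - w|)).
  move=> vb; rewrite ler_wpM2l ?mulr_ge0 //.
  have -> : v = w + (v - w) by ring.
  apply: le_trans (expsum_shift _ _ x0) _.
  rewrite ler_wpM2l ?(le_trans _ (expsum_ge1 _ x0)) // ler_expR ler_wpM2l //.
  move: vb; have [wz|zw] := leP w z => /andP[v1 v2].
    by rewrite !ger0_norm ?subr_ge0 //; lra.
  by rewrite !ler0_norm ?subr_le0 ?(ltW zw) //; lra.
have := @piecewise_mvt_norm_le (fun u => u * steinF x u) _ _ _ _ x w z 0
  (300 * (1 - Phi x) * (expsum x w * expR (x * `|z - w|)))
  (is_derive_id_steinL x) (is_derive_id_steinU x).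
rewrite mul0r subr0 => M; rewrite mulrAC; apply: M.
- by move=> u ux; rewrite steinF_lower.
- by move=> u ux; rewrite steinF_upper.
- move=> v vb vx; rewrite subr0; apply: le_trans (B _ vb).
  exact: id_steinL_deriv_bound.
- move=> v vb vx; rewrite subr0; apply: le_trans (B _ vb).
  exact: id_steinU_deriv_bound.
Qed.

Lemma indic_shift w y : ~~ (`|w - x| <= `|y|) -> (x <= w + y) = (x <= w).
Proof.
have y1 := ler_norm y; have y2 := ler_norm (- y); rewrite normrN in y2.
rewrite -ltNge ltr_normr => /orP[h|h]; apply/idP/idP; lra.
Qed.

Lemma steinD_step w y :
  `|steinD x (w + y) - steinD x w| <=
  300 * (1 - Phi x) * `|y| * (expsum x w * expR (x * `|y|)) +
  (`|w - x| <= `|y|)%R%:R.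
Proof.
have := id_steinF_lipschitz w (w + y).
have -> : w + y - w = y by ring.
move=> h; rewrite /steinD.
set a := _ * steinF x (w + y) in h *; set b := _ * steinF x w in h *.
have -> : a + (1 - Phi x) - (x <= w + y)%R%:R - (b + (1 - Phi x) - (x <= w)%R%:R) =
  (a - b) + ((x <= w)%R%:R - (x <= w + y)%R%:R) by ring.
apply: le_trans (ler_normD _ _) _; apply: lerD => //.
have [_|/indic_shift ->] := boolP (`|w - x| <= `|y|); last by rewrite subrr normr0.
by case: (x <= w); case: (x <= w + y); rewrite /= ler_norml; lra.
Qed.

(** The positive part of w - x has derivative 1(x <= w), with an error only when
    the step crosses the kink. *)
Lemma pos_part_step w y :
  `|Num.max (w + y - x) 0 - Num.max (w - x) 0 - y * (x <= w)%R%:R| <=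
  `|y| * (`|w - x| <= `|y|)%R%:R.
Proof.
have [h|h] := boolP (`|w - x| <= `|y|); last first.
  have := indic_shift h; rewrite mulr0.
  have [e1|e1] := leP x w; have [e2|e2] := leP x (w + y) => // _.
    by rewrite !max_l ?subr_ge0 //= mulr1 normr_le0; apply/eqP; ring.
  by rewrite !max_r ?subr_le0 ?(ltW e1) ?(ltW e2) //= mulr0 !subr0 normr0.
have y1 := ler_norm y; have y2 := ler_norm (- y); rewrite normrN in y2.
move: h; rewrite /= mulr1 !ler_norml => /andP[h1 h2].
have [e1|e1] := leP x w; have [e2|e2] := leP (w + y - x) 0;
  have [e3|e3] := leP (w - x) 0; rewrite /= ?mulr1 ?mulr0 ?subr0;
  apply/andP; split; have [y0|y0] := leP 0 y;
  rewrite ?(ger0_norm y0) ?(ltr0_norm y0) in y1 y2 h1 h2 *; lra.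
Qed.

(** The jump of [steinD] is that of - 1(x <= w), so G = F + (w - x)^+ - (1 - Phi x) w
    is continuously differentiable with derivative w F(w), whose increments
    [id_steinF_lipschitz] controls.  The kink is accounted for separately by
    [pos_part_step]. *)
Lemma steinF_step w y :
  `|steinF x (w + y) - steinF x w - y * steinD x w| <=
  `|y| * (300 * (1 - Phi x) * `|y| * (expsum x w * expR (x * `|y|)) +
          (`|w - x| <= `|y|)%R%:R).
Proof.
(* The combination from which the jump of the derivative is removed. *)
pose G u := steinF x u + Num.max (u - x) 0 - (1 - Phi x) * u.
set k := 300 * (1 - Phi x) * `|y| * _.
have px : 0 <= 1 - Phi x by rewrite subr_ge0 Phi_le1.
have dL u : is_derive u 1 (fun v => steinL x v - (1 - Phi x) * v) (u * steinL x u).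
  have h := is_derive_steinL x u.
  by apply: is_derive_eq; rewrite /GRing.scale /=; ring.
have dU u : is_derive u 1 (fun v => steinU x v + (v - x) - (1 - Phi x) * v)
    (u * steinU x u).
  have h := is_derive_steinU x u.
  by apply: is_derive_eq; rewrite /GRing.scale /=; ring.
have near u : Num.min w (w + y) <= u <= Num.max w (w + y) ->
    `|u * steinF x u - w * steinF x w| <= k.
  move=> ub; apply: le_trans (id_steinF_lipschitz _ _) _.
  have uy : `|u - w| <= `|y|.
    move: ub; have [wz|zw] := leP w (w + y) => /andP[v1 v2].
      by rewrite !ger0_norm ?subr_ge0 //; lra.
    by rewrite !ler0_norm ?subr_le0 //; lra.
  have E0 := le_trans ler01 (expsum_ge1 w x0).
  apply: ler_pM; rewrite ?mulr_ge0 ?expR_ge0 //.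
    by rewrite ler_wpM2l ?mulr_ge0.
  by rewrite ler_wpM2l // ler_expR ler_wpM2l.
have GE : `|G (w + y) - G w - w * steinF x w * (w + y - w)| <= k * `|w + y - w|.
  apply: (piecewise_mvt_norm_le (x := x) dL dU).
  - by move=> u ux; rewrite /G max_r ?subr_le0 // addr0 steinF_lower.
  - by move=> u ux; rewrite /G max_l ?subr_ge0 // steinF_upper.
  - by move=> u ub ux; rewrite -steinF_lower //; exact: near.
  - by move=> u ub ux; rewrite -steinF_upper //; exact: near.
move: GE; have -> : w + y - w = y by ring.
have := pos_part_step w y; rewrite /G /steinD.
set F1 := steinF x (w + y); set F2 := steinF x w.
set m1 := Num.max _ _; set m2 := Num.max _ _; set i := (_)%:R; set i' := (_)%:R.
move=> h1 h2.
have -> : F1 - F2 - y * (w * F2 + (1 - Phi x) - i) =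
  (F1 + m1 - (1 - Phi x) * (w + y) - (F2 + m2 - (1 - Phi x) * w) - w * F2 * y)
  - (m1 - m2 - y * i) by ring.
apply: le_trans (ler_normB _ _) _.
apply: le_trans (lerD h2 h1) _.
by rewrite [k * _]mulrC -mulrDr.
Qed.

End Fixed.

End Stein.

(** * Test functions for the concentration inequality *)

Section Pointwise.
Variable R : realType.
Implicit Types (a b g m p s t u v w x : R).

(** A bounded substitute for the identity as test function in Stein's identity,
    from which the mean of the negative part of a sum is bounded. *)
Definition clip u : R := Num.max (-1) (Num.min u 1).

Lemma clip_spec u : (u <= -1 /\ clip u = -1) \/
  (-1 <= u <= 1 /\ clip u = u) \/ (1 <= u /\ clip u = 1).
Proof.
rewrite /clip; have [u1|/ltW u1] := leP u 1; last first.
  by right; right; rewrite max_r //; lra.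
have [u2|/ltW u2] := leP (-1) u; last by left.
by right; left.
Qed.

Lemma clip_norm_le1 u : `|clip u| <= 1.
Proof.
by rewrite ler_norml; have [[? ->]|[[/andP[? ?] ->]|[? ->]]] := clip_spec u; lra.
Qed.

Lemma negpart_le_clip u : Num.max (- u) 0 <= 1 + u * clip u.
Proof.
by rewrite ge_max; have [[? ->]|[[/andP[? ?] ->]|[? ->]]] := clip_spec u; nra.
Qed.

Lemma clip_lipschitz u v : `|clip (v + u) - clip v| <= `|u|.
Proof.
have uu := ler_norm u; have un := ler_norm (- u); rewrite normrN in un.
rewrite ler_norml.
by have [[? ->]|[[/andP[? ?] ->]|[? ->]]] := clip_spec v;
  have [[? ->]|[[/andP[? ?] ->]|[? ->]]] := clip_spec (v + u); lra.
Qed.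

Lemma min_lipschitz_ge0 u v b : 0 <= u ->
  0 <= Num.min (v + u) b - Num.min v b <= u.
Proof.
move=> u0; have [h|h] := leP (v + u) b; have [k|k] := leP v b; lra.
Qed.

Lemma expR_sub_le s t : t <= s -> expR s - expR t <= (s - t) * expR s.
Proof.
move=> ts; have e := expR_ge1Dx (t - s).
have -> : expR s - expR t = (1 - expR (t - s)) * expR s.
  by rewrite mulrBl mul1r -expRD subrK.
by rewrite ler_wpM2r ?expR_ge0 //; lra.
Qed.

(** The cutoff at [b] makes the exponential bounded; the estimate does not
    depend on [b]. *)
Lemma expR_min_lipschitz x b v u : 0 <= x ->
  `|expR (x * Num.min (v + u) b) - expR (x * Num.min v b)| <=
  x * `|u| * expR (x * v + x * `|u|).
Proof.
move=> x0.
(* Both signs of [u] reduce to a step of length [p] that ends at [w]. *)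
have main p w : 0 <= p -> x * w <= x * v + x * `|u| -> p <= `|u| ->
    `|expR (x * Num.min w b) - expR (x * Num.min (w - p) b)| <=
    x * `|u| * expR (x * v + x * `|u|).
  move=> p0 wv pu.
  have := min_lipschitz_ge0 (w - p) b p0; rewrite subrK => /andP[m1 m2].
  have xm : x * Num.min (w - p) b <= x * Num.min w b by rewrite ler_wpM2l // -subr_ge0.
  rewrite ger0_norm ?subr_ge0 ?ler_expR //.
  apply: le_trans (expR_sub_le xm) _.
  rewrite -mulrBr; apply: ler_pM; rewrite ?expR_ge0 ?mulr_ge0 //.
    by rewrite ler_wpM2l // (le_trans m2).
  by rewrite ler_expR (le_trans _ wv) // ler_wpM2l // ge_min lexx.
have uu := ler_norm u; have un := ler_norm (- u); rewrite normrN in un.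
have xu := ler_wpM2l x0 uu; have xn : 0 <= x * `|u| by rewrite mulr_ge0.
have [u0|/ltW u0] := leP 0 u.
  have := main u (v + u) u0; rewrite addrK; apply=> //; lra.
rewrite distrC; have := main (- u) v; rewrite opprK; apply=> //; lra.
Qed.

(** Between the square of [u] and [g] times its absolute value: large enough to
    have a mean close to the variance, and at most [g * `|u|] so that its
    exponential moments are under control. *)
Definition trunc2 g u : R := `|u| * Num.min `|u| g.

Lemma trunc2_ge0 g u : 0 <= g -> 0 <= trunc2 g u.
Proof. by move=> g0; rewrite mulr_ge0 // le_min normr_ge0. Qed.

Lemma trunc2_le_sqr g u : trunc2 g u <= u ^+ 2.
Proof.
by rewrite -(real_normK (num_real u)) expr2 ler_wpM2l // ge_min lexx.
Qed.

Lemma trunc2_le_norm g u : trunc2 g u <= g * `|u|.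
Proof. by rewrite /trunc2 [g * _]mulrC ler_wpM2l // ge_min lexx orbT. Qed.

(** For t >= 0 both t and g dominate t - t^2/(4 g), the second because
    (t - 2 g)^2 >= 0. *)
Lemma trunc2_ge g u : 0 < g -> u ^+ 2 - `|u| ^+ 3 / (4 * g) <= trunc2 g u.
Proof.
move=> g0; rewrite -(real_normK (num_real u)) /trunc2.
move: (normr_ge0 u); move: `|u| => t t0.
have -> : t ^+ 2 - t ^+ 3 / (4 * g) = t * (t - t ^+ 2 / (4 * g)).
  by field; rewrite gt_eqF.
have t2 : 0 <= t ^+ 2 / (4 * g) by rewrite divr_ge0 ?sqr_ge0 //; lra.
rewrite ler_wpM2l // le_min; apply/andP; split; first lra.
rewrite lerBlDr -lerBlDl ler_pdivlMr; last lra.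
by have := sqr_ge0 (t - 2 * g); nra.
Qed.

(** The first-order gain - [trunc2 g u / g] of the exponent survives multiplication
    by e^(x u), up to third moments; this is what makes the weighted event of a
    small sum of truncated squares unlikely.  The right-hand side is written as
    a combination of the functions whose expectations are named later. *)
Lemma expR_trunc2_le x g u : 0 <= x -> 0 < g ->
  expR (x * u - trunc2 g u / g) <=
  1 + x * u + (x ^+ 2 / 2 * u ^+ 2 + x ^+ 3 * (`|u| ^+ 3 * expR (x * `|u|))) -
  g^-1 * (u ^+ 2 - (4 * g)^-1 * (`|u| ^+ 3 * expR (x * `|u|)) -
          x * (`|u| ^+ 3 * expR (x * `|u|))) +
  `|u| ^+ 2 * expR (x * `|u|).
Proof.
move=> x0 g0.
have gi : 0 < g^-1 by rewrite invr_gt0.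
have r0 : 0 <= trunc2 g u / g by rewrite divr_ge0 ?trunc2_ge0 // ltW.
have e0 := expR_gt0 (x * u).
have ru : trunc2 g u / g <= `|u|.
  by rewrite ler_pdivrMr // mulrC trunc2_le_norm.
have u0 := normr_ge0 u.
have E1 : 1 <= expR (x * `|u|) by rewrite -expR0 ler_expR mulr_ge0.
have W3 : `|u| ^+ 3 <= `|u| ^+ 3 * expR (x * `|u|) by rewrite ler_peMr ?exprn_ge0.
have ee : expR (x * u) <= expR (x * `|u|) by rewrite ler_expR ler_wpM2l ?ler_norm.
have t3 : expR (x * u) <= 1 + x * u + (x ^+ 2 / 2 * u ^+ 2 + x ^+ 3 * (`|u| ^+ 3 * expR (x * `|u|))).
  have := expR_taylor3 (x * u); rewrite ler_norml => /andP[_].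
  by rewrite normrM (ger0_norm x0) !exprMn; lra.
have tr := trunc2_ge u g0.
(* The tilted gain: 1 - x |u| <= e^(x u), and the loss is of third order. *)
have low : u ^+ 2 - (4 * g)^-1 * (`|u| ^+ 3 * expR (x * `|u|)) -
    x * (`|u| ^+ 3 * expR (x * `|u|)) <= trunc2 g u * expR (x * u).
  have c4 : 0 <= (4 * g)^-1 by rewrite invr_ge0; lra.
  have h1 := ler_wpM2l c4 W3; have h2 := ler_wpM2l x0 W3.
  have h3 := expR_ge1Dx (x * u).
  have h4 : - (x * `|u|) <= x * u.
    by rewrite -mulrN ler_wpM2l // lerNl -normrN ler_norm.
  have h5 : trunc2 g u * (x * `|u|) <= x * `|u| ^+ 3.
    have -> : x * `|u| ^+ 3 = `|u| ^+ 2 * (x * `|u|) by ring.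
    by rewrite ler_wpM2r ?mulr_ge0 // real_normK ?num_real ?trunc2_le_sqr.
  have h6 : trunc2 g u * (1 - x * `|u|) <= trunc2 g u * expR (x * u).
    by rewrite ler_wpM2l ?trunc2_ge0 ?(ltW g0) //; lra.
  lra.
have up : expR (x * u) * (trunc2 g u / g) ^+ 2 <= `|u| ^+ 2 * expR (x * `|u|).
  rewrite mulrC; apply: ler_pM => //; rewrite ?sqr_ge0 ?(ltW e0) //.
  by rewrite lerXn2r ?nnegrE.
have key : expR (x * u - trunc2 g u / g) <=
    expR (x * u) * (1 - trunc2 g u / g + (trunc2 g u / g) ^+ 2).
  by rewrite expRD ler_pM2l // expRN_le_quadratic.
apply: le_trans key _.
have low' := ler_wpM2l (ltW gi) low.
have -> : expR (x * u) * (1 - trunc2 g u / g + (trunc2 g u / g) ^+ 2) =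
  expR (x * u) - g^-1 * (trunc2 g u * expR (x * u)) +
  expR (x * u) * (trunc2 g u / g) ^+ 2 by ring.
by apply: lerD => //; apply: lerB.
Qed.

(** Increasing from 0 at a - g and constant beyond [b], with the weight e^(x w) that
    plays the role of a change of measure.  Being constant to the right keeps
    it bounded, as a test function in Stein's identity has to be. *)
Definition ramp x a b g w : R :=
  expR (x * Num.min w b) * Num.max 0 (Num.min w b - a + g).

Lemma ramp_ge0 x a b g w : 0 <= ramp x a b g w.
Proof. by rewrite mulr_ge0 ?expR_ge0 // le_max lexx. Qed.

Lemma ramp_mono x a b g v w : 0 <= x -> v <= w ->
  ramp x a b g v <= ramp x a b g w.
Proof.
move=> x0 vw; have m : Num.min v b <= Num.min w b.
  by rewrite le_min !ge_min lexx vw orbT.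
apply: ler_pM; rewrite ?expR_ge0 //.
- by rewrite le_max lexx.
- by rewrite ler_expR ler_wpM2l.
- by rewrite ge_max !le_max lexx /=; apply/orP; right; lra.
Qed.

Lemma ramp_le x a b g w : 0 <= g -> a <= b ->
  ramp x a b g w <= (b - a + g) * expR (x * Num.min w b).
Proof.
move=> g0 ab.
have bag : 0 <= b - a + g by rewrite addr_ge0 // subr_ge0.
have mb : Num.min w b <= b by rewrite ge_min lexx orbT.
have h : Num.max 0 (Num.min w b - a + g) <= b - a + g.
  by rewrite ge_max bag lerD2r lerD2r.
by rewrite /ramp [leRHS]mulrC ler_wpM2l ?expR_ge0.
Qed.

Lemma ramp_bound x a b g w : 0 <= x -> 0 <= g -> a <= b ->
  `|ramp x a b g w| <= (b - a + g) * expR (x * b).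
Proof.
move=> x0 g0 ab; rewrite ger0_norm ?ramp_ge0 //.
apply: le_trans (ramp_le _ _ g0 ab) _.
rewrite ler_wpM2l ?ler_expR ?ler_wpM2l ?ge_min ?lexx ?orbT //; lra.
Qed.

Lemma ramp_growth x a b g v w : 0 <= x -> a - g <= v -> v <= w -> w <= b ->
  expR (x * (a - g)) * (w - v) <= ramp x a b g w - ramp x a b g v.
Proof.
move=> x0 av vw wb; rewrite /ramp !min_l ?(le_trans vw) //.
rewrite !max_r; [|lra|lra].
have e1 : expR (x * (a - g)) <= expR (x * v) by rewrite ler_expR ler_wpM2l.
have e2 : expR (x * v) <= expR (x * w) by rewrite ler_expR ler_wpM2l.
have h1 : expR (x * (a - g)) * (w - v) <= expR (x * v) * (w - v).
  by rewrite ler_wpM2r // subr_ge0.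
have h2 : expR (x * v) * (w - a + g) <= expR (x * w) * (w - a + g).
  by rewrite ler_wpM2r //; lra.
lra.
Qed.

Lemma ramp_increment_ge0 x a b g v u : 0 <= x ->
  0 <= u * (ramp x a b g (v + u) - ramp x a b g v).
Proof.
move=> x0.
have [u0|/ltW u0] := leP 0 u.
  by rewrite mulr_ge0 // subr_ge0 ramp_mono // lerDl.
by rewrite mulr_le0 // subr_le0 ramp_mono // gerDl.
Qed.

(** Of the step from [v] to [v + u], the part of length min(|u|, g) that ends at
    [v + u] stays inside the interval [a - g, b] where the slope is at least
    e^(x (a - g)); monotonicity takes care of the rest. *)
Lemma ramp_increment_ge x a b g v u : 0 <= x -> 0 <= g ->
  a <= v + u -> v + u <= b - g ->
  expR (x * (a - g)) * trunc2 g u <=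
  u * (ramp x a b g (v + u) - ramp x a b g v).
Proof.
move=> x0 g0 av vb.
have E0 := expR_ge0 (x * (a - g)).
rewrite /trunc2; set c := Num.min `|u| g.
have c0 : 0 <= c by rewrite le_min normr_ge0.
have cu : c <= `|u| by rewrite ge_min lexx.
have cg : c <= g by rewrite ge_min lexx orbT.
have [u0|/ltW u0] := leP 0 u.
  rewrite mulrCA (ger0_norm u0) ler_wpM2l //.
  rewrite (ger0_norm u0) in cu.
  have := @ramp_growth x a b g (v + u - c) (v + u) x0.
  have -> : v + u - (v + u - c) = c by ring.
  move=> G; apply: (le_trans (G _ _ _)); [lra|lra|lra|].
  by rewrite lerD2l lerN2 ramp_mono //; lra.
rewrite (ler0_norm u0) in cu *.
have -> : u * (ramp x a b g (v + u) - ramp x a b g v) =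
  - u * (ramp x a b g v - ramp x a b g (v + u)) by ring.
rewrite mulrCA ler_wpM2l ?oppr_ge0 //.
have := @ramp_growth x a b g (v + u) (v + u + c) x0.
have -> : v + u + c - (v + u) = c by ring.
move=> G; apply: (le_trans (G _ _ _)); [lra|lra|lra|].
by rewrite lerD2r ramp_mono //; lra.
Qed.

(** For negative [w] the left-hand side is at most 0, and the negative part makes
    up for the negative first term on the right. *)
Lemma id_ramp_le x a b g w : 0 <= x -> 0 <= g -> a <= b ->
  w * ramp x a b g w <=
  (b - a + g) * (w * expR (x * Num.min w b) + Num.max (- w) 0).
Proof.
move=> x0 g0 ab; have L0 : 0 <= b - a + g by lra.
have [w0|/ltW w0] := leP 0 w.
  apply: le_trans (ler_wpM2l w0 (ramp_le x w g0 ab)) _.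
  by rewrite mulrCA ler_wpM2l // lerDl le_max lexx orbT.
apply: (@le_trans _ _ 0); first by rewrite mulr_le0_ge0 // ramp_ge0.
rewrite mulr_ge0 // max_l ?oppr_ge0 //.
have : expR (x * Num.min w b) <= 1.
  rewrite -expR0 ler_expR mulr_ge0_le0 //.
  by rewrite ge_min w0.
nra.
Qed.

End Pointwise.

(** * Independence of one variable from a sum of others *)

Section Independence.
Context (R : realType) d (T : measurableType d) (P : probability T R).

Definition indep2 (X Y : T -> R) := forall A B : set R, measurable A -> measurable B ->
  P (X @^-1` A `&` Y @^-1` B) = (P (X @^-1` A) * P (Y @^-1` B))%E.

Lemma measurable_preimage (X : T -> R) (A : set R) : measurable_fun setT X ->
  measurable A -> measurable (X @^-1` A).
Proof. by move=> mX mA; rewrite -[_ @^-1` _]setTI; exact: mX. Qed.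

Section Joint.
Variables X Y : T -> R.
Hypotheses (mX : measurable_fun setT X) (mY : measurable_fun setT Y).
Let X' : {mfun T >-> R} := HB.pack X (isMeasurableFun.Build _ _ _ _ X mX).
Let Y' : {mfun T >-> R} := HB.pack Y (isMeasurableFun.Build _ _ _ _ Y mY).

(** A product rule that holds up to a constant on the rectangles within an event
    [E] extends to all plane Borel sets, by uniqueness of product measures.
    [E] stands for an event about further variables, and [c] for its
    probability. *)
Lemma joint_law_scaled (E : set T) (c : R) : measurable E -> 0 < c ->
  (forall A B, measurable A -> measurable B ->
    P (X @^-1` A `&` Y @^-1` B `&` E) = (c%:E * (P (X @^-1` A) * P (Y @^-1` B)))%E) ->
  forall Z : set (R * R), measurable Z ->
    P ([set w | Z (X w, Y w)] `&` E) =
    (c%:E * (distribution P X' \x distribution P Y') Z)%E.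
Proof.
move=> mE c0 H Z mZ.
have mXY : measurable_fun setT (fun w => (X w, Y w)) by exact: measurable_fun_pair.
pose XY' : {mfun T >-> (R * R)%type} := HB.pack (fun w => (X w, Y w))
  (isMeasurableFun.Build _ _ _ _ _ mXY).
have ci : 0 <= c^-1 by rewrite invr_ge0 ltW.
pose pm : {measure set (R * R)%type -> \bar R} := pushforward (mrestr P mE) XY'.
pose m' := mscale (NngNum ci) (pm mXY).
have -> : (distribution P X' \x distribution P Y')%E Z = m' Z.
  apply: (product_measure_unique (m' := m')).
  - move=> A B mA mB; rewrite /m' /mscale /= /pushforward /mrestr /=.
    transitivity ((c^-1)%:E * P (X @^-1` A `&` Y @^-1` B `&` E))%E; first by [].
    by rewrite H // muleA -EFinM mulVf ?gt_eqF // mul1e.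
  - exact: mZ.
rewrite /m' /mscale /= /pushforward /mrestr /= muleA -EFinM mulfV ?gt_eqF // mul1e.
by [].
Qed.

Lemma joint_law : indep2 X Y -> forall Z : set (R * R), measurable Z ->
  P [set w | Z (X w, Y w)] = (distribution P X' \x distribution P Y')%E Z.
Proof.
move=> XY Z mZ; rewrite -[LHS](congr1 P (setIT _)).
rewrite (joint_law_scaled measurableT ltr01) ?mul1e // => A B mA mB.
by rewrite setIT mul1e XY.
Qed.

(** The joint law is the product of the marginals, so this is Tonelli's
    theorem. *)
Lemma ge0_integral_indep2 (f : (R * R)%type -> R) : indep2 X Y ->
  measurable_fun setT f -> (forall z, 0 <= f z) ->
  (\int[P]_w (f (X w, Y w))%:E = \int[P]_w (\int[P]_u (f (X w, Y u))%:E))%E.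
Proof.
move=> XY mf f0.
have mXY : measurable_fun setT (fun w => (X w, Y w)) by exact: measurable_fun_pair.
pose XY' : {mfun T >-> (R * R)%type} := HB.pack (fun w => (X w, Y w))
  (isMeasurableFun.Build _ _ _ _ _ mXY).
pose g z := (f z)%:E.
have mg : measurable_fun setT g by exact/measurable_EFinP.
have g0 z : (0 <= g z)%E by rewrite lee_fin.
transitivity (\int[distribution P XY']_z g z)%E.
  by rewrite ge0_integral_distribution.
transitivity (\int[distribution P X' \x distribution P Y']_z g z)%E.
  by apply: eq_measure_integral => A mA _; exact: joint_law.
rewrite fubini_tonelli1 //= /fubini_F /=.
rewrite ge0_integral_distribution //=; last 2 first.
- exact: (measurable_fun_fubini_tonelli_F (m2 := distribution P Y') g).
- by move=> x; apply: integral_ge0 => y _; exact: g0.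
apply: eq_integral => w _ /=; rewrite ge0_integral_distribution //.
by apply: (measurableT_comp mg); exact: measurable_fun_pair.
Qed.

End Joint.

Section Sums.
Variables (n : nat) (xi : 'I_n -> {RV P >-> R}).
Hypothesis xi_indep : mutually_independent xi.
Variable f : 'I_n -> R -> R.
Hypothesis mf : forall i, measurable_fun setT (f i).

Definition psum (S : {set 'I_n}) (w : T) : R := \sum_(j in S) f j (xi j w).

Lemma measurable_psum S : measurable_fun setT (psum S).
Proof.
rewrite /psum; under eq_fun do rewrite big_mkcond.
apply: measurable_sum => j.
by case: (j \in S) => //; exact: measurableT_comp.
Qed.

Let rect (J : {set 'I_n}) (B : 'I_n -> set R) := \bigcap_(i in [set` J]) (xi i @^-1` B i).

Lemma measurable_rect J B : (forall i, measurable (B i)) -> measurable (rect J B).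
Proof.
move=> mB; apply: fin_bigcap_measurable; first exact: finite_finset.
by move=> i _; exact: measurable_preimage.
Qed.

(** Induction on the number of summands.  The last summand is split off and
    moved into the product over the remaining indices, so the statement has to
    carry these indices along: independence of the partial sum and of the
    summand is needed jointly with the event on all other variables. *)
Lemma psum_indep_rect S B C : (forall i, measurable (B i)) -> measurable C ->
  P (psum S @^-1` C `&` rect (~: S) B) =
  (P (psum S @^-1` C) * \prod_(i in ~: S) P (xi i @^-1` B i))%E.
Proof.
move: {2}#|S|.+1 (ltnSn #|S|) => m; elim: m S B C => // m IH S B C Sm mB mC.
have [->|[k kS]] := set_0Vmem S.
  have -> : psum finset.set0 = cst 0 by apply/funext => w; rewrite /psum big_set0.
  have [C0|C0] := pselect (C 0).
    rewrite (_ : _ @^-1` C = setT); last by apply/seteqP; split.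
    by rewrite setTI probability_setT mul1e; exact: xi_indep.
  rewrite (_ : _ @^-1` C = set0); last by apply/seteqP; split.
  by rewrite set0I measure0 mul0e.
set S' := S :\ k.
have kS' : k \notin ~: S by rewrite inE kS.
have S'E : ~: S' = k |: ~: S by apply/finset.setP => i; rewrite /S' !inE negb_and negbK.
have S'm : (#|S'| < m)%N by rewrite (cardsD1 k) kS in Sm.
have mE := measurable_rect (~: S) mB.
have rectE B' D : rect (~: S') (fun j => if j == k then D else B' j) =
    xi k @^-1` D `&` rect (~: S) B'.
  rewrite S'E /rect; apply/seteqP; split=> w.
    move=> H; split; first by have := H k; rewrite /= setU11 eqxx; apply.
    move=> j /= jS; have := H j; rewrite /= setU1r // => /(_ isT).
    by case: eqP => // jk; rewrite -jk jS in kS'.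
  move=> [H1 H2] j /=; rewrite in_setU1 => /orP[/eqP ->|jS]; first by rewrite eqxx.
  by case: eqP => [->//|_]; exact: H2.
(* The probability of the event on the variables outside [S]. *)
pose c := (\prod_(i in ~: S) P (xi i @^-1` B i))%E.
have cfin : c \is a fin_num
  by apply: prode_fin_num => i _; apply: fin_num_measure; exact: measurable_preimage.
have c0 : (0 <= c)%E by apply: prode_ge0.
have H B' A D : (forall i, measurable (B' i)) -> measurable A -> measurable D ->
    P (psum S' @^-1` A `&` xi k @^-1` D `&` rect (~: S) B') =
    (\prod_(i in ~: S) P (xi i @^-1` B' i) *
       (P (psum S' @^-1` A) * P (xi k @^-1` D)))%E.
  move=> mB' mA mD; rewrite -setIA -rectE IH //; last by move=> i; case: ifP.
  rewrite S'E big_setU1 //= eqxx (eq_bigr (fun i => P (xi i @^-1` B' i))).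
    by rewrite muleA muleC.
  by move=> i iS; case: eqP => // ik; rewrite -ik iS in kS'.
have SE w : psum S w = psum S' w + f k (xi k w).
  by rewrite /psum (big_setD1 k) //= addrC.
pose Z : set (R * R) := [set z | C (z.1 + f k z.2)].
have mZ : measurable Z.
  have : measurable_fun setT (fun z : R * R => z.1 + f k z.2).
    by apply: measurable_funD => //; exact: measurableT_comp.
  by move=> /(_ measurableT C mC); rewrite setTI.
have ZE : psum S @^-1` C = [set w | Z (psum S' w, xi k w)].
  by apply/seteqP; split=> w; rewrite /Z /= SE.
rewrite -/c.
(* A null event cannot be used for scaling, but both sides vanish with it. *)
have [c00|cn0] := eqVneq c 0%E.
  rewrite c00 mule0; apply/eqP; rewrite eq_le measure_ge0 andbT.
  have : P (rect (~: S) B) = 0%E by rewrite /rect xi_indep.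
  move <-; apply: le_measure; rewrite ?inE //.
  by apply: measurableI => //; apply: measurable_preimage => //; exact: measurable_psum.
have cp : 0 < fine c by rewrite fine_gt0 // lt0e cn0 c0 ltey_eq cfin.
have mk : measurable_fun setT (xi k) by [].
rewrite ZE (joint_law_scaled (measurable_psum S') mk mE cp) ?fineK //; last first.
  by move=> A D mA mD; exact: H.
rewrite -(joint_law (measurable_psum S') mk) //; first by rewrite muleC.
(* The plain product rule is the case of the full event. *)
move=> A D mA mD; have := H (fun=> setT) A D (fun=> measurableT) mA mD.
rewrite big1 => [|i _]; last by rewrite preimage_setT probability_setT.
rewrite (_ : rect _ _ = setT); first by rewrite setIT mul1e.
by apply/seteqP; split=> // w _ i _; exact: I.
Qed.

Lemma indep2_xi_psum i (S : {set 'I_n}) : i \notin S -> indep2 (xi i) (psum S).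
Proof.
move=> iS A C mA mC.
have mB (j : 'I_n) : measurable (if j == i then A else setT : set R) by case: ifP.
have := psum_indep_rect S mB mC.
have iC : i \in ~: S by rewrite inE.
rewrite (bigD1 i) //= eqxx big1 ?mule1; last first.
  by move=> j /andP[_ /negPf ->]; rewrite preimage_setT probability_setT.
rewrite [in RHS]muleC => <-; congr (P _); rewrite [RHS]setIC; congr (_ `&` _).
apply/seteqP; split=> w /=.
  by move=> wA j _; case: eqP => // ->.
by move=> /(_ i) /=; rewrite iC eqxx; apply.
Qed.

End Sums.
End Independence.

(** * Real-valued expectations *)

Lemma measurable_bool_natr (R : realType) d (U : measurableType d) (b : U -> bool) :
  measurable_fun setT b -> measurable_fun setT (fun u => (b u)%:R : R).
Proof.
move=> mb; rewrite (_ : (fun u => _) = fun u => if b u then 1 else 0 : R); last first.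
  by apply/funext => u; case: (b u).
exact: measurable_fun_ifT.
Qed.

Section Expectation.
Context (R : realType) d (T : measurableType d) (P : probability T R).
Implicit Types (f g : T -> R) (k : R).

(** Expectations take real values here so that estimates can be combined by
    linear arithmetic; the price is an integrability condition in each rule. *)
Definition L1 f : Prop := P.-integrable setT (EFin \o f).
Definition Ex f : R := \int[P]_w f w.

Lemma L1_measurable f : L1 f -> measurable_fun setT f.
Proof. by move=> /integrableP[/measurable_EFinP]. Qed.

Lemma Ex_EFin f : L1 f -> (Ex f)%:E = (\int[P]_w (f w)%:E)%E.
Proof. by move=> Lf; rewrite fineK //; exact: integrable_fin_num. Qed.

Lemma L1_of_expectation f : measurable_fun setT f -> (forall w, 0 <= f w) ->
  ('E_P[f] < +oo)%E -> L1 f.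
Proof.
move=> mf f0; rewrite unlock => fin; apply/integrableP; split.
  exact/measurable_EFinP.
by under eq_integral do rewrite /= ger0_norm //.
Qed.

Lemma L1_cst k : L1 (fun=> k).
Proof. exact: finite_measure_integrable_cst. Qed.

Lemma L1_le f g : measurable_fun setT f -> L1 g -> (forall w, `|f w| <= g w) -> L1 f.
Proof.
move=> mf Lg fg; apply: (le_integrable _ _ _ Lg) => //; first exact/measurable_EFinP.
by move=> w _ /=; rewrite lee_fin (le_trans (fg w)) // ler_norm.
Qed.

Lemma L1_bounded f k : measurable_fun setT f -> (forall w, `|f w| <= k) -> L1 f.
Proof. by move=> mf; apply: L1_le => //; exact: L1_cst. Qed.

Lemma L1_abs f : L1 f -> L1 (fun w => `|f w|).
Proof. exact: integrable_norm. Qed.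

Lemma L1D f g : L1 f -> L1 g -> L1 (fun w => f w + g w).
Proof. by move=> Lf Lg; exact: (integrableD _ Lf Lg). Qed.

Lemma L1B f g : L1 f -> L1 g -> L1 (fun w => f w - g w).
Proof. by move=> Lf Lg; exact: (integrableB _ Lf Lg). Qed.

Lemma L1Z k f : L1 f -> L1 (fun w => k * f w).
Proof. by move=> Lf; exact: (integrableZl _ _ Lf). Qed.

Lemma L1Zr k f : L1 f -> L1 (fun w => f w * k).
Proof.
move=> Lf; have := L1Z k Lf.
by rewrite (_ : (fun w => k * f w) = fun w => f w * k) //; apply/funext => w; rewrite mulrC.
Qed.

Lemma sum_nil_fun (I : Type) (Q : pred I) (F : I -> T -> R) :
  (fun w => \sum_(i <- [::] | Q i) F i w) = fun=> 0.
Proof. by apply/funext => w; rewrite big_nil. Qed.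

Lemma sum_cons_fun (I : Type) i (s : seq I) (Q : pred I) (F : I -> T -> R) :
  (fun w => \sum_(j <- i :: s | Q j) F j w) =
  if Q i then fun w => F i w + \sum_(j <- s | Q j) F j w
  else fun w => \sum_(j <- s | Q j) F j w.
Proof. by case: ifPn => Qi; apply/funext => w; rewrite big_cons ?Qi ?(negPf Qi). Qed.

Lemma L1_sum (I : Type) (s : seq I) (Q : pred I) (F : I -> T -> R) :
  (forall i, Q i -> L1 (F i)) -> L1 (fun w => \sum_(i <- s | Q i) F i w).
Proof.
move=> LF; elim: s => [|i s IH]; first by rewrite sum_nil_fun; exact: L1_cst.
by rewrite sum_cons_fun; case: ifP => // /LF Li; exact: L1D.
Qed.

Lemma Ex_cst k : Ex (fun=> k) = k.
Proof.
apply: EFin_inj; rewrite Ex_EFin; last exact: L1_cst.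
by rewrite integral_cst //= probability_setT mule1.
Qed.

Lemma ExD f g : L1 f -> L1 g -> Ex (fun w => f w + g w) = Ex f + Ex g.
Proof. exact: RintegralD. Qed.

Lemma ExB f g : L1 f -> L1 g -> Ex (fun w => f w - g w) = Ex f - Ex g.
Proof. exact: RintegralB. Qed.

Lemma ExZ k f : L1 f -> Ex (fun w => k * f w) = k * Ex f.
Proof. exact: RintegralZl. Qed.

Lemma ExZr k f : L1 f -> Ex (fun w => f w * k) = Ex f * k.
Proof. exact: RintegralZr. Qed.

Lemma Ex_sum (I : Type) (s : seq I) (Q : pred I) (F : I -> T -> R) :
  (forall i, Q i -> L1 (F i)) ->
  Ex (fun w => \sum_(i <- s | Q i) F i w) = \sum_(i <- s | Q i) Ex (F i).
Proof.
move=> LF; elim: s => [|i s IH]; first by rewrite sum_nil_fun Ex_cst big_nil.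
rewrite big_cons sum_cons_fun; case: ifP => // /LF Li.
by rewrite ExD ?IH //; exact: L1_sum.
Qed.

Lemma Ex_le f g : L1 f -> L1 g -> (forall w, f w <= g w) -> Ex f <= Ex g.
Proof. by move=> Lf Lg fg; apply: le_Rintegral. Qed.

Lemma Ex_ge0 f : (forall w, 0 <= f w) -> 0 <= Ex f.
Proof. by move=> f0; apply: Rintegral_ge0. Qed.

Lemma Ex_norm_le f g : L1 f -> L1 g -> (forall w, `|f w| <= g w) -> `|Ex f| <= Ex g.
Proof.
move=> Lf Lg fg; apply: (le_trans (le_normr_Rintegral _ Lf)) => //.
by apply: Ex_le => //; exact: L1_abs.
Qed.

Lemma Ex_indicator (b : T -> bool) : measurable [set w | b w] ->
  L1 (fun w => (b w)%:R) /\ Ex (fun w => (b w)%:R) = fine (P [set w | b w]).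
Proof.
move=> mb; have -> : (fun w => (b w)%:R) = \1_[set w | b w] :> (T -> R).
  by apply/funext => w; rewrite indicE mem_setE.
split; first by apply: integrable_indic => //; rewrite fin_num_fun_lty.
by rewrite /Ex /Rintegral integral_indic // setIT.
Qed.

Section Indep.
Variables X Y : T -> R.
Hypotheses (mX : measurable_fun setT X) (mY : measurable_fun setT Y).
Hypothesis XY : indep2 P X Y.

(** Conditioning on [X]: a bound on the expectation over [Y] for each frozen
    value of [X] can be averaged over [X]. *)
Lemma indep_le (F : (R * R)%type -> R) (k : R -> R) : measurable_fun setT F ->
  (forall z, 0 <= F z) ->
  (forall x, L1 (fun w => F (x, Y w)) /\ Ex (fun w => F (x, Y w)) <= k x) ->
  L1 (fun w => k (X w)) ->
  L1 (fun w => F (X w, Y w)) /\ Ex (fun w => F (X w, Y w)) <= Ex (fun w => k (X w)).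
Proof.
move=> mF F0 Fk Lk.
have mFXY : measurable_fun setT (fun w => F (X w, Y w)).
  by apply: (measurableT_comp mF); exact: measurable_fun_pair.
have I0 : (\int[P]_w (F (X w, Y w))%:E <= \int[P]_w (k (X w))%:E)%E.
  rewrite (ge0_integral_indep2 mX mY XY mF F0).
  have -> : (fun w => \int[P]_u (F (X w, Y u))%:E)%E =
      fun w => (Ex (fun u => F (X w, Y u)))%:E.
    by apply/funext => w; rewrite -Ex_EFin //; have [] := Fk (X w).
  apply: ge0_le_integral => //.
  - by move=> w _; rewrite lee_fin; apply: Ex_ge0.
  - have -> : (fun w => (Ex (fun u => F (X w, Y u)))%:E) =
        (fun x => \int[P]_u (F (x, Y u))%:E)%E \o X.
      by apply/funext => w /=; rewrite -Ex_EFin //; have [] := Fk (X w).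
    apply: measurableT_comp mX.
    pose G (z : (R * T)%type) := (F (z.1, Y z.2))%:E.
    apply: (measurable_fun_fubini_tonelli_F (m2 := P) G) => [|z]; last by rewrite lee_fin.
    apply/measurable_EFinP; apply: (measurableT_comp mF).
    by apply: measurable_fun_pair => //; exact: measurableT_comp.
  - by apply/measurable_EFinP; exact: L1_measurable.
  - by move=> w _; rewrite lee_fin; have [] := Fk (X w).
have LF : L1 (fun w => F (X w, Y w)).
  apply/integrableP; split; first exact/measurable_EFinP.
  under eq_integral do rewrite /= ger0_norm //.
  by apply: le_lt_trans I0 _; rewrite -Ex_EFin // ltry.
by split=> //; rewrite -lee_fin !Ex_EFin.
Qed.

Lemma indep_mul_ge0 (a b : R -> R) : measurable_fun setT a -> measurable_fun setT b ->
  (forall x, 0 <= a x) -> (forall x, 0 <= b x) ->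
  L1 (fun w => a (X w)) -> L1 (fun w => b (Y w)) ->
  L1 (fun w => a (X w) * b (Y w)) /\
  Ex (fun w => a (X w) * b (Y w)) = Ex (fun w => a (X w)) * Ex (fun w => b (Y w)).
Proof.
move=> ma mb a0 b0 La Lb.
pose F (z : (R * R)%type) := a z.1 * b z.2.
have mF : measurable_fun setT F by apply: measurable_funM; exact: measurableT_comp.
have F0 z : 0 <= F z by rewrite mulr_ge0.
have [] := @indep_le F (fun x => a x * Ex (fun w => b (Y w))) mF F0.
- by move=> x; split; [exact: (L1Z (a x) Lb) | rewrite /F /= ExZ].
- exact: L1Zr.
move=> LF _; split=> //.
apply: EFin_inj; rewrite Ex_EFin // (ge0_integral_indep2 mX mY XY mF F0) -ExZr //.
rewrite Ex_EFin; last exact: L1Zr.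
by apply: eq_integral => w _; rewrite -Ex_EFin /F /= ?ExZ //; exact: L1Z.
Qed.

(** Reduced to nonnegative functions by splitting both factors into positive and
    negative parts. *)
Lemma indep_mul (a b : R -> R) : measurable_fun setT a -> measurable_fun setT b ->
  L1 (fun w => a (X w)) -> L1 (fun w => b (Y w)) ->
  L1 (fun w => a (X w) * b (Y w)) /\
  Ex (fun w => a (X w) * b (Y w)) = Ex (fun w => a (X w)) * Ex (fun w => b (Y w)).
Proof.
move=> ma mb La Lb.
pose ps (h : R -> R) x := Num.max (h x) 0; pose ng (h : R -> R) x := Num.max (- h x) 0.
have psng h x : h x = ps h x - ng h x.
  by rewrite /ps /ng; have [] := leP (h x) 0; have [] := leP (- h x) 0; lra.
have ps0 h x : 0 <= ps h x by rewrite le_max lexx orbT.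
have ng0 h x : 0 <= ng h x by rewrite le_max lexx orbT.
have mps h : measurable_fun setT h -> measurable_fun setT (ps h).
  by move=> mh; exact: measurable_maxr.
have mng h : measurable_fun setT h -> measurable_fun setT (ng h).
  by move=> mh; apply: measurable_maxr => //; exact: measurableT_comp.
have psle h x : `|ps h x| <= `|h x|.
  by rewrite ger0_norm // ge_max ler_norm normr_ge0.
have ngle h x : `|ng h x| <= `|h x|.
  by rewrite ger0_norm // ge_max -normrN ler_norm normr_ge0.
have Lps h Z : measurable_fun setT Z -> measurable_fun setT h ->
    L1 (fun w => h (Z w)) -> L1 (fun w => ps h (Z w)).
  move=> mZ mh /L1_abs Lh; apply: (L1_le _ Lh) => [|w]; last exact: psle.
  exact: (measurableT_comp (mps _ mh)).
have Lng h Z : measurable_fun setT Z -> measurable_fun setT h ->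
    L1 (fun w => h (Z w)) -> L1 (fun w => ng h (Z w)).
  move=> mZ mh /L1_abs Lh; apply: (L1_le _ Lh) => [|w]; last exact: ngle.
  exact: (measurableT_comp (mng _ mh)).
have [L1' E1] := indep_mul_ge0 (mps _ ma) (mps _ mb) (ps0 _) (ps0 _)
   (Lps _ _ mX ma La) (Lps _ _ mY mb Lb).
have [L2' E2] := indep_mul_ge0 (mps _ ma) (mng _ mb) (ps0 _) (ng0 _)
   (Lps _ _ mX ma La) (Lng _ _ mY mb Lb).
have [L3' E3] := indep_mul_ge0 (mng _ ma) (mps _ mb) (ng0 _) (ps0 _)
   (Lng _ _ mX ma La) (Lps _ _ mY mb Lb).
have [L4' E4] := indep_mul_ge0 (mng _ ma) (mng _ mb) (ng0 _) (ng0 _)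
   (Lng _ _ mX ma La) (Lng _ _ mY mb Lb).
have -> : (fun w => a (X w) * b (Y w)) = fun w =>
   (ps a (X w) * ps b (Y w) - ps a (X w) * ng b (Y w)) -
   (ng a (X w) * ps b (Y w) - ng a (X w) * ng b (Y w)).
  by apply/funext => w; rewrite (psng a) (psng b); ring.
split; first by apply: L1B; exact: L1B.
rewrite ExB ?ExB //; try exact: L1B.
rewrite (_ : (fun w => a (X w)) = fun w => ps a (X w) - ng a (X w)); last first.
  by apply/funext => w; rewrite -psng.
rewrite (_ : (fun w => b (Y w)) = fun w => ps b (Y w) - ng b (Y w)); last first.
  by apply/funext => w; rewrite -psng.
rewrite E1 E2 E3 E4 !ExB; try (by [exact: Lps | exact: Lng]).
  ring.
all: by [exact: Lps | exact: Lng].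
Qed.

End Indep.
End Expectation.

(** * Moments of sums of independent variables *)

Ltac meas := repeat first
  [ by [] | assumption
  | apply: measurable_funM | apply: measurable_funD | apply: measurable_funB
  | apply: measurable_funX
  | apply: (measurableT_comp (@measurable_expR _)) | apply: (measurableT_comp (@normr_measurable _ setT))
  | apply: (measurableT_comp (@oppr_measurable _ setT)) | apply: measurable_fun_ler | apply: measurable_minr | apply: measurable_maxr ].

Section IndependentSums.
Context (R : realType) d (T : measurableType d) (P : probability T R).
Variables (n : nat) (xi : 'I_n -> {RV P >-> R}).
Hypothesis xi_indep : mutually_independent xi.
Local Notation L1 := (L1 P).
Local Notation Ex := (Ex P).

(** The expectation factors by independence; bounds on the factors are given in
    exponential form so that their exponents add up. *)
Lemma Ex_expR_psum (f : 'I_n -> R -> R) (b : 'I_n -> R) (S : {set 'I_n}) :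
  (forall i, measurable_fun setT (f i)) ->
  (forall i, i \in S -> L1 (fun w => expR (f i (xi i w)))) ->
  (forall i, i \in S -> Ex (fun w => expR (f i (xi i w))) <= expR (b i)) ->
  L1 (fun w => expR (psum xi f S w)) /\
  Ex (fun w => expR (psum xi f S w)) <= expR (\sum_(i in S) b i).
Proof.
move=> mf.
move: {2}#|S|.+1 (ltnSn #|S|) => m; elim: m S => // m IH S Sm Lf Ef.
have [S0|[k kS]] := set_0Vmem S.
  rewrite S0 big_set0 expR0 (_ : (fun w => _) = fun=> 1); last first.
    by apply/funext => w; rewrite /psum big_set0 expR0.
  by rewrite Ex_cst; split=> //; exact: L1_cst.
have S'm : (#|S :\ k| < m)%N by rewrite (cardsD1 k) kS in Sm.
have [||L' E'] := IH (S :\ k) S'm.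
- by move=> i /setD1P[_ iS]; exact: Lf.
- by move=> i /setD1P[_ iS]; exact: Ef.
have kS' : k \notin S :\ k by rewrite !inE eqxx.
have mp := measurable_psum xi mf (S :\ k).
have XY := indep2_xi_psum xi_indep mf kS'.
have mk : measurable_fun setT (xi k) by [].
have [L2 E2] := indep_mul_ge0 mk mp XY
  (measurableT_comp (@measurable_expR R) (mf k)) (@measurable_expR R)
  (fun u => expR_ge0 _) (fun u => expR_ge0 _) (Lf k kS) L'.
rewrite (_ : (fun w => expR (psum xi f S w)) =
    fun w => expR (f k (xi k w)) * expR (psum xi f (S :\ k) w)); last first.
  by apply/funext => w; rewrite -expRD /psum (big_setD1 k).
split=> //; rewrite E2 (big_setD1 k) //= expRD.
apply: ler_pM => //.
- by apply: Ex_ge0 => w; exact: expR_ge0.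
- by apply: Ex_ge0 => w; exact: expR_ge0.
- exact: Ef.
Qed.

Definition vsum (S : {set 'I_n}) : T -> R := psum xi (fun _ u => u) S.

Lemma measurable_vsum S : measurable_fun setT (vsum S).
Proof. by apply: measurable_psum. Qed.

Lemma indep2_xi_vsum i (S : {set 'I_n}) : i \notin S -> indep2 P (xi i) (vsum S).
Proof. by apply: indep2_xi_psum. Qed.

Lemma vsumD1 (S : {set 'I_n}) k w : k \in S -> vsum S w = vsum (S :\ k) w + xi k w.
Proof. by move=> kS; rewrite /vsum /psum (big_setD1 k) //= addrC. Qed.

Hypothesis Lxi : forall i, L1 (xi i).
Hypothesis Exi : forall i, Ex (xi i) = 0.

Lemma L1_mul_bounded (f h : T -> R) (k : R) : L1 f -> measurable_fun setT h ->
  (forall w, `|h w| <= k) -> L1 (fun w => f w * h w).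
Proof.
move=> Lf mh hk; have mf := L1_measurable Lf.
apply: (L1_le _ (L1Zr k (L1_abs Lf))) => [|w]; first exact: measurable_funM.
by rewrite normrM ler_wpM2l.
Qed.

(** The subtracted term [xi j w * h (vsum (S :\ j) w)] has expectation zero, as
    [xi j] is centred and independent of the sum of the others. *)
Lemma stein_identity (S : {set 'I_n}) (h : R -> R) (k : R) :
  measurable_fun setT h -> (forall u, `|h u| <= k) ->
  Ex (fun w => vsum S w * h (vsum S w)) =
  \sum_(j in S) Ex (fun w => xi j w * (h (vsum S w) - h (vsum (S :\ j) w))).
Proof.
move=> mh hk.
have mhV S' : measurable_fun setT (fun w => h (vsum S' w)).
  by apply: (measurableT_comp mh); exact: measurable_vsum.
have LxV j S' : L1 (fun w => xi j w * h (vsum S' w)) by exact: L1_mul_bounded.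
rewrite (_ : (fun w => vsum S w * h (vsum S w)) =
   fun w => \sum_(j in S) xi j w * h (vsum S w)); last first.
  by apply/funext => w; rewrite -mulr_suml.
rewrite Ex_sum //; apply: eq_bigr => j jS.
rewrite (_ : (fun w => xi j w * (_ - _)) =
   fun w => xi j w * h (vsum S w) - xi j w * h (vsum (S :\ j) w)); last first.
  by apply/funext => w; rewrite mulrBr.
rewrite ExB //.
have jS' : j \notin S :\ j by rewrite !inE eqxx.
have Lh : L1 (fun w => h (vsum (S :\ j) w))
  by exact: (@L1_bounded _ _ _ P _ k (mhV (S :\ j)) (fun w => hk _)).
have [_ ->] := @indep_mul _ _ _ P (xi j) _ (@measurable_funPT _ _ _ _ (xi j)) (measurable_vsum (S :\ j))
  (indep2_xi_vsum jS') id h (@measurable_id _ _ setT) mh (Lxi j) Lh.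
by rewrite (_ : Ex (fun w => xi j w) = 0) ?Exi // mul0r subr0.
Qed.

Variable x : R.
Hypothesis x0 : 0 <= x.
Hypothesis Lq : forall i, L1 (fun w => `|xi i w| ^+ 3 * expR (x * `|xi i w|)).

Definition var2 i := Ex (fun w => xi i w ^+ 2).
Definition abs3 i := Ex (fun w => `|xi i w| ^+ 3 * expR (x * `|xi i w|)).
Definition gam := \sum_i abs3 i.

Lemma abs3_ge0 i : 0 <= abs3 i.
Proof. by apply: Ex_ge0 => w; rewrite mulr_ge0 ?expR_ge0 ?exprn_ge0. Qed.

Lemma gam_ge0 : 0 <= gam.
Proof. by apply: sumr_ge0 => i _; exact: abs3_ge0. Qed.

(** At most 1 in absolute value or not: in the first case the weight is bounded,
    in the second the cube dominates 1. *)
Lemma L1_comp_xi i (h : R -> R) c : measurable_fun setT h ->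
  (forall u, `|h u| <= c * ((1 + `|u| ^+ 3) * expR (x * `|u|))) ->
  L1 (fun w => h (xi i w)).
Proof.
move=> mh hc.
have Lw : L1 (fun w => expR x + 2 * (`|xi i w| ^+ 3 * expR (x * `|xi i w|))).
  by apply: L1D; [exact: L1_cst | exact: L1Z].
have mhx : measurable_fun setT (fun w => h (xi i w)) by exact: measurableT_comp.
apply: (L1_le mhx (L1Z `|c| Lw)) => w; apply: le_trans (hc _) _.
have e0 := expR_ge0 (x * `|xi i w|).
have u3 : 0 <= `|xi i w| ^+ 3 by rewrite exprn_ge0.
apply: (@le_trans _ _ (`|c| * ((1 + `|xi i w| ^+ 3) * expR (x * `|xi i w|)))).
  by rewrite ler_wpM2r ?ler_norm // mulr_ge0 // addr_ge0.
rewrite ler_wpM2l //.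
suff : expR (x * `|xi i w|) <= expR x + `|xi i w| ^+ 3 * expR (x * `|xi i w|).
  by rewrite mulrDl mul1r; lra.
have [u1|u1] := leP `|xi i w| 1.
  have : expR (x * `|xi i w|) <= expR x by rewrite ler_expR ler_piMr.
  by have := mulr_ge0 u3 e0; lra.
have u31 : 1 <= `|xi i w| ^+ 3 by rewrite exprn_ege1 // ltW.
by have := expR_ge0 x; nra.
Qed.

Lemma L1_xi_weight i k : (k <= 3)%N ->
  L1 (fun w => `|xi i w| ^+ k * expR (x * `|xi i w|)).
Proof.
move=> k3; apply: (@L1_comp_xi i (fun u => `|u| ^+ k * expR (x * `|u|)) 1); first by meas.
move=> u; rewrite mul1r normrM (ger0_norm (expR_ge0 _)) ger0_norm ?exprn_ge0 //.
rewrite ler_wpM2r ?expR_ge0 //.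
have [u1|/ltW u1] := leP `|u| 1.
  by rewrite (@le_trans _ _ 1) ?exprn_ile1 // lerDl exprn_ge0.
by rewrite (@le_trans _ _ (`|u| ^+ 3)) ?ler_weXn2l // lerDr.
Qed.

Lemma L1_xi2 i : L1 (fun w => xi i w ^+ 2).
Proof.
apply: (L1_le _ (@L1_xi_weight i 2 isT)) => [|w]; first by meas.
by rewrite normrX ler_peMr ?exprn_ge0 // -expR0 ler_expR mulr_ge0.
Qed.

Lemma L1_xi_expR i y : `|y| <= x -> L1 (fun w => expR (y * xi i w)).
Proof.
move=> yx; apply: (L1_le _ (@L1_xi_weight i 0 isT)) => [|w]; first by meas.
rewrite expr0 mul1r ger0_norm ?expR_ge0 // ler_expR.
by rewrite (le_trans (ler_norm _)) // normrM ler_wpM2r.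
Qed.

Lemma second_moment_le i :
  Ex (fun w => `|xi i w| ^+ 2 * expR (x * `|xi i w|)) <= var2 i + x * abs3 i.
Proof.
rewrite /var2 /abs3 -ExZ // -ExD; [|exact: L1_xi2|exact: L1Z].
apply: Ex_le; [exact: L1_xi_weight|by apply: L1D; [exact: L1_xi2|exact: L1Z]|move=> w].
have h := expR_le_1Dmul (mulr_ge0 x0 (normr_ge0 (xi i w))).
rewrite -(real_normK (num_real (xi i w))).
apply: le_trans (ler_wpM2l (exprn_ge0 2 (normr_ge0 _)) h) _.
by apply: ler_of_eq; ring.
Qed.

(** Chebyshev's association inequality for the square and the increasing weight
    h(u) = u^k e^(x u) of |xi_i|: with a^2 the variance, the product
    (u^2 - a^2)(h(u) - h(a)) is nonnegative, and h(a) drops out since u^2 - a^2 has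
    mean zero. *)
Lemma weight_assoc i k : (k <= 1)%N ->
  var2 i * Ex (fun w => `|xi i w| ^+ k * expR (x * `|xi i w|)) <=
  Ex (fun w => `|xi i w| ^+ k.+2 * expR (x * `|xi i w|)).
Proof.
move=> k1; pose h (u : R) := u ^+ k * expR (x * u).
have Lh : L1 (fun w => h `|xi i w|) by apply: L1_xi_weight; rewrite (leq_trans k1).
have L2h : L1 (fun w => `|xi i w| ^+ k.+2 * expR (x * `|xi i w|)) by exact: L1_xi_weight.
have v0 : 0 <= var2 i by apply: Ex_ge0 => w; exact: sqr_ge0.
(* The threshold where the square crosses its mean. *)
pose a := Num.sqrt (var2 i).
have aa : a ^+ 2 = var2 i by exact: sqr_sqrtr.
have a0 : 0 <= a by exact: sqrtr_ge0.
have mono u v : 0 <= u -> u <= v -> h u <= h v.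
  move=> u0 uv; apply: ler_pM; rewrite ?exprn_ge0 ?expR_ge0 //.
    by rewrite lerXn2r ?nnegrE // (le_trans u0).
  by rewrite ler_expR ler_wpM2l.
have L3 : L1 (fun w => var2 i * h `|xi i w| + h a * (xi i w ^+ 2 - var2 i)).
  apply: L1D; first exact: L1Z.
  by apply/L1Z/L1B; [exact: L1_xi2|exact: L1_cst].
have -> : var2 i * Ex (fun w => h `|xi i w|) =
    Ex (fun w => var2 i * h `|xi i w| + h a * (xi i w ^+ 2 - var2 i)).
  rewrite ExD; [|exact: L1Z|by apply/L1Z/L1B; [exact: L1_xi2|exact: L1_cst]].
  rewrite !ExZ //; last by apply: L1B; [exact: L1_xi2|exact: L1_cst].
  rewrite ExB; [|exact: L1_xi2|exact: L1_cst].
  by rewrite Ex_cst subrr mulr0 addr0.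
apply: Ex_le => // w.
rewrite -(real_normK (num_real (xi i w))) -aa; move: (normr_ge0 (xi i w)).
move: `|xi i w| => u u0; rewrite -subr_ge0 -/(h u).
have -> : u ^+ k.+2 * expR (x * u) - (a ^+ 2 * h u + h a * (u ^+ 2 - a ^+ 2)) =
   (u ^+ 2 - a ^+ 2) * (h u - h a) by rewrite /h !exprS; ring.
have [ua|/ltW au] := leP u a.
  rewrite mulr_le0 // subr_le0 ?mono //.
  by rewrite lerXn2r ?nnegrE.
rewrite mulr_ge0 // subr_ge0 ?mono //.
by rewrite lerXn2r ?nnegrE.
Qed.

(** A third-order expansion of the exponential; the linear term vanishes in the
    mean. *)
Lemma mgf_le i y : 0 <= y <= x ->
  Ex (fun w => expR (y * xi i w)) <= expR (y ^+ 2 / 2 * var2 i + y ^+ 3 * abs3 i).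
Proof.
move=> /andP[y0 yx].
apply: le_trans (expR_ge1Dx _).
have L2 := L1_xi2 i; have L2' := L1Z (y ^+ 2 / 2) L2; have L3 := L1Z (y ^+ 3) (Lq i).
have Ly := L1Z y (Lxi i).
have L12 := L1D (L1_cst P 1) Ly; have L123 := L1D L12 (L1D L2' L3).
have -> : 1 + (y ^+ 2 / 2 * var2 i + y ^+ 3 * abs3 i) =
    Ex (fun w => 1 + y * xi i w + (y ^+ 2 / 2 * xi i w ^+ 2 +
      y ^+ 3 * (`|xi i w| ^+ 3 * expR (x * `|xi i w|)))).
  rewrite (ExD L12 (L1D L2' L3)) (ExD (L1_cst P 1) Ly) (ExD L2' L3) Ex_cst !ExZ //.
  by rewrite Exi mulr0 addr0.
apply: Ex_le => // [|w]; first by apply: L1_xi_expR; rewrite ger0_norm.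
have := expR_taylor3 (y * xi i w); rewrite ler_norml => /andP[_].
rewrite normrM (ger0_norm y0) !exprMn.
have e : expR (y * `|xi i w|) <= expR (x * `|xi i w|) by rewrite ler_expR ler_wpM2r.
have c0 : 0 <= y ^+ 3 * `|xi i w| ^+ 3 by rewrite mulr_ge0 ?exprn_ge0.
have := ler_wpM2l c0 e; lra.
Qed.

Hypothesis sum_var2 : \sum_i var2 i = 1.

Lemma var2_ge0 i : 0 <= var2 i.
Proof. by apply: Ex_ge0 => w; exact: sqr_ge0. Qed.

Lemma sum_sub_le (a : 'I_n -> R) (S : {set 'I_n}) : (forall i, 0 <= a i) ->
  \sum_(i in S) a i <= \sum_i a i.
Proof.
move=> a0; rewrite [leRHS](bigID (mem S)) /= lerDl.
by apply: sumr_ge0.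
Qed.

Lemma vsum_mgf (S : {set 'I_n}) y : 0 <= y <= x ->
  L1 (fun w => expR (y * vsum S w)) /\
  Ex (fun w => expR (y * vsum S w)) <= expR (y ^+ 2 / 2 + y ^+ 3 * gam).
Proof.
move=> yx; have /andP[y0 yx'] := yx.
have eqV : (fun w => expR (y * vsum S w)) = fun w => expR (psum xi (fun _ u => y * u) S w).
  by apply/funext => w; rewrite /vsum /psum mulr_sumr.
have [||| L E] := @Ex_expR_psum (fun _ u => y * u)
  (fun i => y ^+ 2 / 2 * var2 i + y ^+ 3 * abs3 i) S.
- by move=> i; meas.
- by move=> i _; apply: L1_xi_expR; rewrite ger0_norm.
- by move=> i _; exact: mgf_le.
rewrite eqV; split=> //; apply: le_trans E _.
rewrite ler_expR big_split /= -!mulr_sumr.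
apply: lerD; last by rewrite ler_wpM2l ?exprn_ge0 // sum_sub_le //; exact: abs3_ge0.
have S1 : \sum_(i in S) var2 i <= 1.
  by rewrite -sum_var2; exact: (sum_sub_le S var2_ge0).
by rewrite -[leRHS]mulr1 ler_wpM2l // divr_ge0 ?sqr_ge0.
Qed.

Lemma L1_vsum S : L1 (vsum S).
Proof. exact: (@L1_sum _ _ _ P 'I_n). Qed.

(** Stein's identity for [clip], which is 1-Lipschitz, bounds E[V clip(V)] by the
    sum of the variances. *)
Lemma negpart_le2 (S : {set 'I_n}) : Ex (fun w => Num.max (- vsum S w) 0) <= 2.
Proof.
have hb := @clip_norm_le1 R.
have mh : measurable_fun setT (@clip R) by rewrite /clip; meas.
have mV := measurable_vsum S.
have LVh : L1 (fun w => vsum S w * clip (vsum S w)).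
  by apply: (L1_mul_bounded (L1_vsum S) _ (fun w => hb _)); exact: measurableT_comp.
apply: (@le_trans _ _ (Ex (fun w => 1 + vsum S w * clip (vsum S w)))).
  apply: Ex_le => [||w].
  - apply: (L1_le _ (L1_abs (L1_vsum S))) => [|w]; first by meas.
    by rewrite ger0_norm ?le_max ?lexx ?orbT // ge_max normr_ge0 -normrN ler_norm.
  - by apply: L1D => //; exact: L1_cst.
  - exact: negpart_le_clip.
rewrite ExD //; last exact: L1_cst.
rewrite Ex_cst lerD2l (stein_identity S mh hb) -sum_var2.
apply: le_trans (sum_sub_le S var2_ge0); apply: ler_sum => j jS.
apply: Ex_le => [||w]; last 1 first.
- rewrite (vsumD1 w jS); move: (vsum _ w) (xi j w) => v u.
  have L := clip_lipschitz u v.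
  apply: le_trans (ler_norm _) _; rewrite normrM -(real_normK (num_real u)) expr2.
  by rewrite ler_wpM2l.
- apply: (L1_mul_bounded (k := 2) (Lxi j)).
    by apply: measurable_funB; apply: (measurableT_comp mh); exact: measurable_vsum.
  by move=> w; apply: le_trans (ler_normB _ _) _; have := hb (vsum S w);
    have := hb (vsum (S :\ j) w); lra.
- exact: L1_xi2.
Qed.

(** Up to the normalization e^(x^2/2) the mean of a sum under the law weighted by
    e^(x V) is about x; the identity for h(v) = e^(x min(v, b)) reduces this to
    the moment generating function at [x]. *)
Lemma tilted_mean_le (S : {set 'I_n}) b :
  Ex (fun w => vsum S w * expR (x * Num.min (vsum S w) b)) <=
  x * (1 + x * gam) * expR (x ^+ 2 / 2 + x ^+ 3 * gam).
Proof.
pose h (u : R) := expR (x * Num.min u b).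
have mh : measurable_fun setT h by rewrite /h; meas.
have hb u : `|h u| <= expR (x * b).
  by rewrite ger0_norm ?expR_ge0 // ler_expR ler_wpM2l // ge_min lexx orbT.
rewrite (stein_identity S mh hb).
set B := expR _; have B0 : 0 <= B by exact: expR_ge0.
have xx : 0 <= x <= x by rewrite x0 lexx.
apply: (@le_trans _ _ (\sum_(j in S) x * (var2 j + x * abs3 j) * B)).
  apply: ler_sum => j jS.
  have jS' : j \notin S :\ j by rewrite !inE eqxx.
  have [LV EV] := vsum_mgf (S :\ j) xx.
  have mj : measurable_fun setT (xi j) by [].
  have L2 := @L1_xi_weight j 2 isT.
  have [||L E] := indep_mul (a := fun u => `|u| ^+ 2 * expR (x * `|u|))
    (b := fun v => expR (x * v)) mj (measurable_vsum (S :\ j)) (indep2_xi_vsum jS') _ _ L2 LV.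
  - by meas.
  - by meas.
  apply: (@le_trans _ _ (Ex (fun w => x *
      (`|xi j w| ^+ 2 * expR (x * `|xi j w|) * expR (x * vsum (S :\ j) w))))).
    apply: Ex_le => [||w]; last 1 first.
    + rewrite (vsumD1 w jS) -/(h _) -/(h _); move: (vsum _ w) (xi j w) => v u.
      have LP : `|h (v + u) - h v| <= _ := expR_min_lipschitz b v u x0.
      apply: le_trans (ler_norm _) _; rewrite normrM.
      apply: le_trans (ler_wpM2l (normr_ge0 u) LP) _.
      by rewrite expRD; apply: ler_of_eq; ring.
    + apply: (L1_mul_bounded (k := expR (x * b) + expR (x * b)) (Lxi j)).
        by apply: measurable_funB; apply: (measurableT_comp mh); exact: measurable_vsum.
      by move=> w; apply: le_trans (ler_normB _ _) _; apply: lerD; exact: hb.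
    + exact: L1Z.
  rewrite ExZ // E -mulrA ler_wpM2l //; apply: ler_pM => //.
  - by apply: Ex_ge0 => w; rewrite mulr_ge0 ?expR_ge0 ?exprn_ge0.
  - by apply: Ex_ge0 => w; rewrite expR_ge0.
  - exact: second_moment_le.
rewrite -mulr_suml -mulr_sumr ler_wpM2r // ler_wpM2l //.
apply: le_trans (sum_sub_le S _) _ => [i|].
  by rewrite addr_ge0 ?var2_ge0 // mulr_ge0 ?abs3_ge0.
by rewrite big_split /= sum_var2 -mulr_sumr.
Qed.

(** * Concentration under the exponential weight *)

Section Concentration.
Hypothesis g_gt0 : 0 < gam.
Hypothesis g_small : gam <= 1 / 64.
Hypothesis xg_small : x * gam <= 1 / 64.
Variable S : {set 'I_n}.
Hypothesis S_large : 7 / 8 <= \sum_(j in S) var2 j.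

(** By [trunc2_ge] the mean of [eta] is at least 7/8 - 1/4. *)
Definition eta w : R := \sum_(j in S) trunc2 gam (xi j w).

Let B : R := expR (x ^+ 2 / 2 + x ^+ 3 * gam).

Lemma trunc_mgf_le i : Ex (fun w => expR (x * xi i w - trunc2 gam (xi i w) / gam)) <=
  expR ((x ^+ 2 / 2 * var2 i + x ^+ 3 * abs3 i) -
    gam^-1 * (var2 i - (4 * gam)^-1 * abs3 i - x * abs3 i) + (var2 i + x * abs3 i)).
Proof.
have L2 := L1_xi2 i; have L3 := Lq i; have L22 := @L1_xi_weight i 2 isT.
have La := L1Z (x ^+ 2 / 2) L2; have Lb := L1Z (x ^+ 3) L3.
have Lab := L1D La Lb.
have Lx := L1D (L1_cst P 1) (L1Z x (Lxi i)).
have Lc := L1Z (4 * gam)^-1 L3; have Ld := L1Z x L3.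
have Le := L1B (L1B L2 Lc) Ld; have Lf := L1Z gam^-1 Le.
have L4 := L1B (L1D Lx Lab) Lf; have L5 := L1D L4 L22.
apply: (@le_trans _ _ (Ex (fun w => 1 + x * xi i w +
  (x ^+ 2 / 2 * xi i w ^+ 2 + x ^+ 3 * (`|xi i w| ^+ 3 * expR (x * `|xi i w|))) -
  gam^-1 * (xi i w ^+ 2 - (4 * gam)^-1 * (`|xi i w| ^+ 3 * expR (x * `|xi i w|)) -
          x * (`|xi i w| ^+ 3 * expR (x * `|xi i w|))) +
  `|xi i w| ^+ 2 * expR (x * `|xi i w|)))).
  apply: Ex_le => // [|w]; last exact: expR_trunc2_le.
  apply: (L1_le _ (@L1_xi_weight i 0 isT)) => [|w].
    by rewrite /trunc2; meas.
  rewrite expr0 mul1r ger0_norm ?expR_ge0 // ler_expR.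
  apply: (@le_trans _ _ (x * xi i w)).
    by rewrite gerBl divr_ge0 ?trunc2_ge0 // ltW.
  by rewrite ler_wpM2l // ler_norm.
rewrite (ExD L4 L22) (ExB (L1D Lx Lab) Lf) (ExD Lx Lab) (ExD (L1_cst P 1) (L1Z x (Lxi i))).
rewrite (ExD La Lb) (ExZ _ Le) (ExB (L1B L2 Lc) Ld) (ExB L2 Lc) !ExZ // Ex_cst Exi mulr0 addr0.
apply: le_trans (expR_ge1Dx _).
have := second_moment_le i; rewrite -/(var2 i) -/(abs3 i); lra.
Qed.

(** Where [eta w] is below 1/4 the integrand is at least e^(x V), so this bounds
    the weighted probability of that event.  The integrand factors over the
    summands: each factor gains e^(- v_i / gam), which in total beats the
    e^(1/(4 gam)) in front by e^(- 1/(4 gam)) <= 4 gam. *)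
Lemma small_eta_le :
  L1 (fun w => expR (x * vsum S w + (1 / 4 - eta w) / gam)) /\
  Ex (fun w => expR (x * vsum S w + (1 / 4 - eta w) / gam)) <= 4 * gam * B.
Proof.
have g0 := g_gt0; have xg := xg_small; have gs := g_small; have SL := S_large.
pose f (i : 'I_n) u : R := x * u - trunc2 gam u / gam.
have [||| L E] := @Ex_expR_psum f (fun i =>
  (x ^+ 2 / 2 * var2 i + x ^+ 3 * abs3 i) -
    gam^-1 * (var2 i - (4 * gam)^-1 * abs3 i - x * abs3 i) + (var2 i + x * abs3 i)) S.
- by move=> i; rewrite /f /trunc2; meas.
- move=> i _; apply: (L1_le _ (@L1_xi_weight i 0 isT)) => [|w].
    by rewrite /f /trunc2; meas.
  rewrite expr0 mul1r ger0_norm ?expR_ge0 // ler_expR.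
  apply: (@le_trans _ _ (x * xi i w)).
    by rewrite gerBl divr_ge0 ?trunc2_ge0 // ltW.
  by rewrite ler_wpM2l // ler_norm.
- by move=> i _; exact: trunc_mgf_le.
have eqV : (fun w => expR (x * vsum S w + (1 / 4 - eta w) / gam)) =
    fun w => expR (1 / 4 / gam) * expR (psum xi f S w).
  apply/funext => w; rewrite -expRD; congr expR.
  by rewrite /vsum /psum /eta /f sumrB mulr_sumr -mulr_suml; ring.
rewrite eqV; split; first exact: L1Z.
rewrite ExZ //; apply: le_trans (ler_wpM2l (expR_ge0 _) E) _.
set s := \sum_(i in S) var2 i; set q := \sum_(i in S) abs3 i.
have s1 : s <= 1 by rewrite -sum_var2; exact: (sum_sub_le S var2_ge0).
have qg : q <= gam by exact: (sum_sub_le S abs3_ge0).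
have q0 : 0 <= q by apply: sumr_ge0 => i _; exact: abs3_ge0.
have -> : \sum_(i in S) ((x ^+ 2 / 2 * var2 i + x ^+ 3 * abs3 i) -
    gam^-1 * (var2 i - (4 * gam)^-1 * abs3 i - x * abs3 i) + (var2 i + x * abs3 i)) =
  x ^+ 2 / 2 * s + x ^+ 3 * q - gam^-1 * (s - (4 * gam)^-1 * q - x * q) + (s + x * q).
  by rewrite !big_split /= !sumrN -!mulr_sumr !big_split /= !sumrN -!mulr_sumr.
rewrite -expRD.
have gi : 0 < gam^-1 by rewrite invr_gt0.
have gi64 : 64 <= gam^-1 by rewrite -[64]invrK lef_pV2 ?posrE ?invr_gt0 // -div1r.
have b1 : (4 * gam)^-1 * q <= 1 / 4.
  by rewrite ler_pdivrMl; lra.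
have b2 : x * q <= x * gam by rewrite ler_wpM2l.
have b3 : gam^-1 * (7 / 8 - 1 / 4 - 1 / 64) <= gam^-1 * (s - (4 * gam)^-1 * q - x * q).
  by rewrite ler_wpM2l ?(ltW gi) // /s; lra.
have b4 : x ^+ 2 / 2 * s <= x ^+ 2 / 2 * 1 by rewrite ler_wpM2l // divr_ge0 ?sqr_ge0.
have b5 : x ^+ 3 * q <= x ^+ 3 * gam by rewrite ler_wpM2l // exprn_ge0.
apply: (@le_trans _ _ (expR (- (gam^-1 / 4) + (x ^+ 2 / 2 + x ^+ 3 * gam)))).
  by rewrite ler_expR; lra.
rewrite expRD -/B ler_wpM2r ?expR_ge0 //.
have e := expR_ge1Dx (gam^-1 / 4).
rewrite expRN -[leRHS]invrK lef_pV2 ?posrE ?expR_gt0 ?invr_gt0 ?mulr_gt0 //.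
by rewrite invfM mulrC; lra.
Qed.

(** Take [a = x - m] and [b = x + m + gam].  On the event in question either
    [eta w] is at least 1/4, and then the increments of [ramp] summed over the
    variables are at least e^(x (a - gam))/4, or [eta w] is below 1/4, and
    [small_eta_le] applies.  By Stein's identity the expectation of the first
    contribution is that of V ramp(V), which is bounded through the weighted
    mean and the negative part of V.  The factor e^(- x^2 + x^2/2) that remains
    is the Gaussian one. *)
Lemma concentration m : 0 <= m ->
  Ex (fun w => (`|vsum S w - x| <= m)%R%:R) <=
  36 * (1 + x) * (m + gam) * expR (x * m) * (expR (- x ^+ 2) * B).
Proof.
move=> m0; have x0' := x0; have g0 := g_gt0; have xg := xg_small; have gs := g_small.
have g00 := ltW g0.
pose a := x - m; pose b := x + m + gam.
have ab : a <= b by rewrite /a /b; lra.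
pose phi := ramp x a b gam.
have mphi : measurable_fun setT phi by rewrite /phi /ramp; meas.
have phib : forall u, `|phi u| <= _ := fun u => ramp_bound u x0 g00 ab.
have mV S' : measurable_fun setT (vsum S') := measurable_vsum S'.
have Linc j : L1 (fun w => xi j w * (phi (vsum S w) - phi (vsum (S :\ j) w))).
  apply: (L1_mul_bounded (k := (b - a + gam) * expR (x * b) + (b - a + gam) * expR (x * b)) (Lxi j)).
    by apply: measurable_funB; apply: (measurableT_comp mphi); exact: mV.
  by move=> w; apply: le_trans (ler_normB _ _) _; apply: lerD; exact: phib.
have [Le Ee] := small_eta_le.
have Linc' : L1 (fun w => \sum_(j in S) xi j w * (phi (vsum S w) - phi (vsum (S :\ j) w))).
  exact: L1_sum.
have LR1 := L1Z (4 * expR (- (x * (a - gam)))) Linc'.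
have LR2 := L1Z (expR (- (x * a))) Le.
have mI : measurable_fun setT (fun w => (`|vsum S w - x| <= m)%R%:R : R).
  by apply: measurable_bool_natr; meas; exact: mV.
have LI : L1 (fun w => (`|vsum S w - x| <= m)%R%:R).
  by apply: (@L1_bounded _ _ _ P _ 1 mI) => w; case: (_ <= m); rewrite /= ?normr1 ?normr0.
have pw w : (`|vsum S w - x| <= m)%R%:R <=
   4 * expR (- (x * (a - gam))) *
     (\sum_(j in S) xi j w * (phi (vsum S w) - phi (vsum (S :\ j) w))) +
   expR (- (x * a)) * expR (x * vsum S w + (1 / 4 - eta w) / gam).
  have inc0 : 0 <= \sum_(j in S) xi j w * (phi (vsum S w) - phi (vsum (S :\ j) w)).
    by apply: sumr_ge0 => j jS; rewrite (vsumD1 w jS) ramp_increment_ge0.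
  have E1 := expR_ge0 (- (x * (a - gam))).
  have E2 := expR_ge0 (- (x * a)).
  have E3 := expR_ge0 (x * vsum S w + (1 / 4 - eta w) / gam).
  have T1 := mulr_ge0 E1 inc0; have T2 := mulr_ge0 E2 E3.
  rewrite -mulrA.
  have [|_] := boolP (`|vsum S w - x| <= m); last by rewrite mulr0n; lra.
  rewrite ler_norml mulr1n => /andP[v1 v2].
  have [e4|e4] := leP (1 / 4) (eta w).
    have : 1 / 4 <= expR (- (x * (a - gam))) *
       (\sum_(j in S) xi j w * (phi (vsum S w) - phi (vsum (S :\ j) w))).
      apply: (le_trans e4).
      rewrite expRN ler_pdivlMl ?expR_gt0 // /eta mulr_sumr.
      apply: ler_sum => j jS; rewrite (vsumD1 w jS).
      by apply: ramp_increment_ge => //; rewrite -(vsumD1 w jS) /a /b; lra.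
    lra.
  have : 1 <= expR (- (x * a)) * expR (x * vsum S w + (1 / 4 - eta w) / gam).
    rewrite -expRD -[leLHS]expR0 ler_expR.
    have h1 : 0 <= (1 / 4 - eta w) / gam by rewrite divr_ge0 //; lra.
    have h2 : x * a <= x * vsum S w by rewrite ler_wpM2l // /a; lra.
    by rewrite addrA addr_ge0 // addrC subr_ge0.
  lra.
apply: le_trans (Ex_le LI (L1D LR1 LR2) pw) _.
rewrite (ExD LR1 LR2) (ExZ _ Linc') (ExZ _ Le) Ex_sum //.
rewrite -(stein_identity S mphi phib).
have B1 : 1 <= B.
  rewrite -expR0 ler_expR addr_ge0 ?divr_ge0 ?sqr_ge0 // mulr_ge0 ?exprn_ge0 //.
have Lh : L1 (fun w => vsum S w * expR (x * Num.min (vsum S w) b)).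
  apply: (L1_mul_bounded (k := expR (x * b)) (L1_vsum S)); first by meas; exact: mV.
  by move=> w; rewrite ger0_norm ?expR_ge0 // ler_expR ler_wpM2l // ge_min lexx orbT.
have Ln : L1 (fun w => Num.max (- vsum S w) 0).
  apply: (L1_le _ (L1_abs (L1_vsum S))) => [|w]; first by meas; exact: mV.
  by rewrite ger0_norm ?le_max ?lexx ?orbT // ge_max normr_ge0 -normrN ler_norm.
have Lphi : L1 (fun w => vsum S w * phi (vsum S w)).
  apply: (L1_mul_bounded (L1_vsum S) _ (fun w => phib _)).
  by apply: (measurableT_comp mphi); exact: mV.
have main : Ex (fun w => vsum S w * phi (vsum S w)) <= 4 * (m + gam) * ((1 + x) * B).
  apply: (le_trans (Ex_le Lphi (L1Z _ (L1D Lh Ln)) (fun w => id_ramp_le _ x0 g00 ab))).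
  rewrite (ExZ _ (L1D Lh Ln)) (ExD Lh Ln).
  have := tilted_mean_le S b; have := negpart_le2 S; rewrite -/B => h1 h2.
  have h3 : x * (1 + x * gam) * B <= 2 * x * B.
    by rewrite ler_wpM2r ?(le_trans ler01) // [2 * x]mulrC ler_wpM2l //; lra.
  have -> : b - a + gam = 2 * (m + gam) by rewrite /a /b; ring.
  have mg : 0 <= m + gam by lra.
  have : Ex (fun w => vsum S w * expR (x * Num.min (vsum S w) b)) +
     Ex (fun w => Num.max (- vsum S w) 0) <= 2 * ((1 + x) * B) by lra.
  move=> h4; have := ler_wpM2l mg h4; lra.
have ea : expR (- (x * a)) = expR (x * m) * expR (- x ^+ 2).
  by rewrite -expRD /a; congr expR; ring.
have eg : expR (- (x * (a - gam))) <= 2 * expR (- (x * a)).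
  have -> : - (x * (a - gam)) = x * gam + - (x * a) by ring.
  rewrite expRD ler_wpM2r ?expR_ge0 //.
  have := expR_ge1Dx (- (x * gam)); rewrite expRN => h.
  have h1 : 1 / 2 <= (expR (x * gam))^-1 by lra.
  by move: h1; rewrite -[1 / 2]invf_div divr1 lef_pV2 ?posrE ?expR_gt0.
rewrite ea in eg *.
set C := expR (x * m) * _ in eg *.
have C0 : 0 <= C by rewrite mulr_ge0 ?expR_ge0.
have -> : 36 * (1 + x) * (m + gam) * expR (x * m) * (expR (- x ^+ 2) * B) =
  C * (36 * ((m + gam) * ((1 + x) * B))) by rewrite /C; ring.
have Q0 : 0 <= 4 * (m + gam) * ((1 + x) * B).
  by rewrite !mulr_ge0 ?(le_trans ler01 B1) //; lra.
have t1 : 4 * expR (- (x * (a - gam))) * Ex (fun w => vsum S w * phi (vsum S w)) <=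
   4 * (2 * C) * (4 * (m + gam) * ((1 + x) * B)).
  apply: (@le_trans _ _ (4 * expR (- (x * (a - gam))) * (4 * (m + gam) * ((1 + x) * B)))).
    by rewrite ler_wpM2l // mulr_ge0 ?expR_ge0.
  by rewrite ler_wpM2r // ler_wpM2l.
have t2 := ler_wpM2l C0 Ee.
have t3 : C * (4 * gam * B) <= C * (4 * ((m + gam) * ((1 + x) * B))).
  rewrite ler_wpM2l // -mulrA ler_wpM2l //.
  have B0 := le_trans ler01 B1.
  rewrite mulrA ler_wpM2r //; nra.
lra.
Qed.

End Concentration.

(** * Comparison of the two tails *)

Lemma measurable_Phi : measurable_fun setT (@Phi R).
Proof.
by apply: continuous_measurable_fun; apply: continuous_of_derive; exact: is_derive_Phi.
Qed.

Lemma measurable_steinF : measurable_fun setT (steinF x).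
Proof.
have mi : measurable_fun setT (@idens R) by rewrite /idens; meas.
have mp := measurable_Phi.
by apply: measurable_fun_ifT; rewrite /steinL /steinU; meas.
Qed.

Lemma measurable_steinD : measurable_fun setT (steinD x).
Proof.
have mF := measurable_steinF.
rewrite /steinD; apply: measurable_funB; last by apply: measurable_bool_natr; meas.
by meas.
Qed.

Lemma measurable_expsum : measurable_fun setT (expsum x).
Proof. by rewrite /expsum; apply: measurable_sum => j; meas. Qed.

(** At each node y the Gaussian factor e^(y^2/2) of the moment generating function
    cancels against e^(-y^2/2). *)
Lemma vsum_expsum_le S : L1 (fun w => expsum x (vsum S w)) /\
  Ex (fun w => expsum x (vsum S w)) <= 6 * (1 + x ^+ 3) * expR (x ^+ 3 * gam).
Proof.
have x0' := x0.
have term (j : nat) : L1 (fun w => (1 + node x j ^+ 2) * expR (node x j * vsum S w - node x j ^+ 2 / 2)) /\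
    Ex (fun w => (1 + node x j ^+ 2) * expR (node x j * vsum S w - node x j ^+ 2 / 2)) <=
    (1 + x ^+ 2) * expR (x ^+ 3 * gam).
  have yx := node_bounds j x0; have /andP[y0 yx'] := yx; move: (node x j) yx y0 yx' => y yx y0 yx'.
  have [L E] := vsum_mgf S yx.
  have -> : (fun w => (1 + y ^+ 2) * expR (y * vsum S w - y ^+ 2 / 2)) =
      fun w => ((1 + y ^+ 2) * expR (- (y ^+ 2 / 2))) * expR (y * vsum S w).
    by apply/funext => w; rewrite -mulrA -expRD [- _ + _]addrC.
  split; first exact: L1Z.
  rewrite ExZ //.
  have c0 : 0 <= (1 + y ^+ 2) * expR (- (y ^+ 2 / 2)).
    by rewrite mulr_ge0 ?expR_ge0 // addr_ge0 ?sqr_ge0.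
  apply: le_trans (ler_wpM2l c0 E) _.
  rewrite -mulrA -expRD addrA addNr add0r; apply: ler_pM; rewrite ?expR_ge0 //.
  - by rewrite addr_ge0 ?sqr_ge0.
  - by rewrite lerD2l lerXn2r ?nnegrE.
  - by rewrite ler_expR ler_wpM2r ?gam_ge0 // lerXn2r ?nnegrE.
have Lt (j : 'I_(Num.trunc x).+2) := (term j).1.
split; first by apply: L1_sum => j _; exact: Lt.
rewrite Ex_sum; last by move=> j _; exact: Lt.
apply: (@le_trans _ _ (\sum_(j < (Num.trunc x).+2) (1 + x ^+ 2) * expR (x ^+ 3 * gam))).
  by apply: ler_sum => j _; exact: (term j).2.
rewrite sumr_const card_ord -[leLHS]mulr_natl mulrA ler_wpM2r ?expR_ge0 //.
have tx : (Num.trunc x)%:R <= x by rewrite truncn_le.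
have -> : (Num.trunc x).+2%:R = (Num.trunc x)%:R + 2 :> R by rewrite -addn2 natrD.
have : (Num.trunc x)%:R + 2 <= x + 2 by rewrite lerD2r.
move=> h; have s0 : 0 <= 1 + x ^+ 2 by rewrite addr_ge0 ?sqr_ge0.
apply: le_trans (ler_wpM2r s0 h) _.
have q := sqr_ge0 (x - 1); have x3 : 0 <= x * (x - 1) ^+ 2 by rewrite mulr_ge0.
have x33 : 0 <= x ^+ 3 by rewrite exprn_ge0.
nra.
Qed.

(** Cut at height [t]; above it the square is at most the cube divided by [t]. *)
Lemma var2_le i t : 0 < t -> var2 i <= t ^+ 2 + t^-1 * abs3 i.
Proof.
move=> t0; rewrite -ExZ // -[X in X + _](Ex_cst P) -ExD; [|exact: L1_cst|exact: L1Z].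
apply: Ex_le; [exact: L1_xi2|by apply: L1D; [exact: L1_cst|exact: L1Z]|move=> w].
rewrite -(real_normK (num_real (xi i w))); move: (normr_ge0 (xi i w)); move: `|_| => u u0.
have E1 : 1 <= expR (x * u) by rewrite -expR0 ler_expR mulr_ge0.
have u3 : u ^+ 3 <= u ^+ 3 * expR (x * u) by rewrite ler_peMr ?exprn_ge0.
have ti : 0 <= t^-1 by rewrite invr_ge0 ltW.
have [ut|/ltW tu] := leP u t.
  rewrite -[leLHS]addr0 lerD //; first by rewrite lerXn2r ?nnegrE // ltW.
  by rewrite !mulr_ge0 ?exprn_ge0 ?expR_ge0.
rewrite -[leLHS]add0r lerD ?sqr_ge0 //; apply: le_trans (ler_wpM2l ti u3).
rewrite ler_pdivlMl // exprS ler_wpM2r ?sqr_ge0 //.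
Qed.

(** If [gam] vanished, the variances would be at most t^2 each for every t > 0,
    and they could not add up to 1. *)
Lemma gam_gt0 : 0 < gam.
Proof.
rewrite lt0r gam_ge0 andbT; apply/eqP => g0.
have n0 : 0 < n%:R + 1 :> R by rewrite ltr_wpDl.
(* Small enough that n t^2 < 1. *)
pose t : R := (n%:R + 1)^-1.
have t0 : 0 < t by rewrite invr_gt0.
have : \sum_i var2 i <= \sum_i (t ^+ 2 + t^-1 * abs3 i).
  by apply: ler_sum => i _; exact: var2_le.
have gE : \sum_i abs3 i = 0 := g0.
rewrite sum_var2 big_split /= sumr_const card_ord -mulr_sumr gE mulr0 addr0 -[leRHS]mulr_natl.
have tn : t * (n%:R + 1) = 1 by rewrite mulVf // gt_eqF.
have nn : 0 <= n%:R :> R by [].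
apply/negP; rewrite -ltNge; nra.
Qed.

Let full : {set 'I_n} := [set: 'I_n].

Section Comparison.
Hypothesis g_small : gam <= 1 / 64.
Hypothesis xg_small : x * gam <= 1 / 64.

(** A single variance is at most 1/16 + 4 gam <= 1/8. *)
Lemma sum_without_ge i : 7 / 8 <= \sum_(j in full :\ i) var2 j.
Proof.
have v := @var2_le i (1 / 4); have := gam_ge0.
have q : abs3 i <= gam.
  by rewrite /gam (bigD1 i) //= lerDl; apply: sumr_ge0 => j _; exact: abs3_ge0.
have := sum_var2; rewrite (bigD1 i) //=.
rewrite (eq_bigl (mem (full :\ i))); last by move=> j; rewrite /full !inE andbT.
have := g_small; have : (1 / 4)^-1 = 4 :> R by rewrite invf_div divr1.
move=> e gs s1 g0; have := v _; rewrite e => /(_ _); move=> H.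
have : var2 i <= (1 / 4) ^+ 2 + 4 * abs3 i by apply: H; lra.
rewrite expr2; lra.
Qed.

Let B : R := expR (x ^+ 2 / 2 + x ^+ 3 * gam).
(* The coefficients of the smooth and of the jump contribution. *)
Let A1 : R := 300 * (1 - Phi x) * (6 * (1 + x ^+ 3) * expR (x ^+ 3 * gam)).
Let A2 : R := 36 * (1 + x) * (expR (- x ^+ 2) * B).

(** A bound for the error that the i-th summand leaves in Stein's method, at the
    value z.1 of the summand and the value z.2 of the sum of the others.  The
    factor [z.1 ^+ 2] comes from the expansion of F, the factor [var2 i] from
    replacing W^i by W in D. *)
Definition err i (z : (R * R)%type) : R :=
  (z.1 ^+ 2 + var2 i) *
    (300 * (1 - Phi x) * `|z.1| * (expsum x z.2 * expR (x * `|z.1|)) +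
     (`|z.2 - x| <= `|z.1|)%R%:R).

(** For a fixed value of xi_i, average over the sum of the others with
    [vsum_expsum_le] and [concentration]; then average over xi_i.  The
    products of the variance with weighted moments of lower order are turned
    into weighted moments of xi_i by [weight_assoc]. *)
Lemma Ex_err_le i :
  L1 (fun w => err i (xi i w, vsum (full :\ i) w)) /\
  Ex (fun w => err i (xi i w, vsum (full :\ i) w)) <=
  2 * (A1 + A2) * abs3 i + 2 * gam * A2 * (var2 i + x * abs3 i).
Proof.
have px : 0 <= 1 - Phi x by rewrite subr_ge0 Phi_le1.
have v0 := var2_ge0 i.
have A10 : 0 <= A1.
  apply: mulr_ge0; first exact: (mulr_ge0 (ler0n R 300) px).
  by rewrite !mulr_ge0 ?expR_ge0 // addr_ge0 ?exprn_ge0.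
have A20 : 0 <= A2 by rewrite /A2 !mulr_ge0 ?expR_ge0 ?addr_ge0 ?ler01.
pose W (k : nat) (u : R) : R := `|u| ^+ k * expR (x * `|u|).
(* The result of averaging [err i (u, _)] over the sum of the other variables. *)
pose kk (u : R) := (A1 + A2) * (W 3 u + var2 i * W 1 u) + gam * A2 * (W 2 u + var2 i * W 0 u).
have LW k : (k <= 3)%N -> L1 (fun w => W k (xi i w)) by exact: L1_xi_weight.
have Lk1 := L1D (LW 3 isT) (L1Z (var2 i) (LW 1 isT)).
have Lk2 := L1D (LW 2 isT) (L1Z (var2 i) (LW 0 isT)).
have Lk := L1D (L1Z (A1 + A2) Lk1) (L1Z (gam * A2) Lk2).
have mi : measurable_fun setT (xi i) by [].
have iS : i \notin full :\ i by rewrite !inE eqxx.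
have m1 : measurable_fun setT (fun z : (R * R)%type => z.1) by exact: measurable_fst.
have m2 : measurable_fun setT (fun z : (R * R)%type => z.2) by exact: measurable_snd.
have mE : measurable_fun setT (err i).
  rewrite /err; apply: measurable_funM; first by meas.
  apply: measurable_funD; last by apply: measurable_bool_natr; meas.
  apply: measurable_funM; first by meas.
  apply: measurable_funM; last by meas.
  by apply: (measurableT_comp measurable_expsum).
have E0 z : 0 <= err i z.
  have H1 := le_trans ler01 (expsum_ge1 z.2 x0).
  rewrite /err; apply: mulr_ge0; first by rewrite addr_ge0 ?sqr_ge0.
  apply: addr_ge0; last exact: ler0n.
  apply: mulr_ge0; last by rewrite mulr_ge0 ?expR_ge0.
  exact: (mulr_ge0 (mulr_ge0 (ler0n R 300) px)).
have [|L E] := indep_le mi (measurable_vsum (full :\ i)) (indep2_xi_vsum iS) (k := kk) mE E0 _ Lk.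
  move=> y.
  have [LH EH] := vsum_expsum_le (full :\ i).
  have C := concentration gam_gt0 g_small xg_small (sum_without_ge i) (normr_ge0 y).
  have LI : L1 (fun w => (`|vsum (full :\ i) w - x| <= `|y|)%R%:R).
    apply: (@L1_bounded _ _ _ P _ 1) => [|w].
      by apply: measurable_bool_natr; meas; exact: measurable_vsum.
    by case: (_ <= `|y|); rewrite ?normr1 ?normr0.
  have eqE : (fun w => err i (y, vsum (full :\ i) w)) = fun w =>
     (y ^+ 2 + var2 i) * ((300 * (1 - Phi x) * `|y| * expR (x * `|y|)) * expsum x (vsum (full :\ i) w) +
       (`|vsum (full :\ i) w - x| <= `|y|)%R%:R).
    by apply/funext => w; rewrite /err /=; congr (_ * (_ + _)); ring.
  have LL := L1D (L1Z (300 * (1 - Phi x) * `|y| * expR (x * `|y|)) LH) LI.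
  rewrite eqE; split; first exact: L1Z.
  rewrite (ExZ _ LL) (ExD (L1Z _ LH) LI) (ExZ _ LH).
  have c0 : 0 <= 300 * (1 - Phi x) * `|y| * expR (x * `|y|).
    exact: (mulr_ge0 (mulr_ge0 (mulr_ge0 (ler0n R 300) px) (normr_ge0 y)) (expR_ge0 _)).
  have y0 : 0 <= y ^+ 2 + var2 i by rewrite addr_ge0 ?sqr_ge0.
  apply: le_trans (ler_wpM2l y0 (lerD (ler_wpM2l c0 EH) C)) _.
  rewrite -(real_normK (num_real y)) /kk /W /A1 /A2 -/B.
  by apply: ler_of_eq; ring.
split=> //; apply: (le_trans E).
rewrite /kk (ExD (L1Z (A1 + A2) Lk1) (L1Z (gam * A2) Lk2)) (ExZ _ Lk1) (ExZ _ Lk2).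
rewrite (ExD (LW 3 isT) (L1Z (var2 i) (LW 1 isT))) (ExD (LW 2 isT) (L1Z (var2 i) (LW 0 isT))).
rewrite (ExZ _ (LW 1 isT)) (ExZ _ (LW 0 isT)).
have a1 : var2 i * Ex (fun w => W 1 (xi i w)) <= abs3 i := weight_assoc i (leqnn 1).
have a0 : var2 i * Ex (fun w => W 0 (xi i w)) <= Ex (fun w => W 2 (xi i w)) :=
  weight_assoc i (leq0n 1).
have s2 := second_moment_le i; rewrite -/(W 2 _) in s2.
have -> : Ex (fun w => W 3 (xi i w)) = abs3 i by [].
have A12 : 0 <= A1 + A2 by rewrite addr_ge0.
have gA : 0 <= gam * A2 by rewrite mulr_ge0 ?gam_ge0.
have h1 : abs3 i + var2 i * Ex (fun w => W 1 (xi i w)) <= 2 * abs3 i by lra.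
have h2 : Ex (fun w => W 2 (xi i w)) + var2 i * Ex (fun w => W 0 (xi i w)) <=
   2 * (var2 i + x * abs3 i) by rewrite /W in a0 *; lra.
apply: le_trans (lerD (ler_wpM2l A12 h1) (ler_wpM2l gA h2)) _.
by apply: ler_of_eq; ring.
Qed.

(** The term xi_i^2 D(W^i) is subtracted and added; by independence it has the
    same mean as v_i D(W^i). *)
Lemma stein_error_term i :
  `|Ex (fun w => xi i w * (steinF x (vsum full w) - steinF x (vsum (full :\ i) w))) -
    var2 i * Ex (fun w => steinD x (vsum full w))| <=
  Ex (fun w => err i (xi i w, vsum (full :\ i) w)).
Proof.
have x0' := x0.
have [Lerr _] := Ex_err_le i.
have mF := measurable_steinF; have mD := measurable_steinD.
have mV S' : measurable_fun setT (vsum S') := measurable_vsum S'.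
have iS : i \notin full :\ i by rewrite !inE eqxx.
have mi : measurable_fun setT (xi i) by [].
have mDV S' : measurable_fun setT (fun w => steinD x (vsum S' w)) := measurableT_comp mD (mV S').
have LD S' : L1 (fun w => steinD x (vsum S' w)).
  by apply: (@L1_bounded _ _ _ P _ 3 (mDV S')) => w; exact: steinD_bound.
have LF : L1 (fun w => xi i w * (steinF x (vsum full w) - steinF x (vsum (full :\ i) w))).
  apply: (L1_mul_bounded (k := 12) (Lxi i)).
    by apply: measurable_funB; apply: (measurableT_comp mF); exact: mV.
  move=> w; have /andP[? ?] := steinF_bound x0 (vsum full w).
  have /andP[? ?] := steinF_bound x0 (vsum (full :\ i) w).
  by rewrite ler_norml; lra.
have L2D : L1 (fun w => xi i w ^+ 2 * steinD x (vsum (full :\ i) w)).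
  by apply: (L1_mul_bounded (k := 3) (L1_xi2 i) (mDV _)) => w; exact: steinD_bound.
have [|_ ED] := indep_mul mi (mV (full :\ i)) (indep2_xi_vsum iS) (a := fun u => u ^+ 2) (b := steinD x) _ mD
  (L1_xi2 i) (LD _).
  by meas.
have LX := L1B LF L2D; have LY := L1Z (var2 i) (L1B (LD (full :\ i)) (LD full)).
have -> : Ex (fun w => xi i w * (steinF x (vsum full w) - steinF x (vsum (full :\ i) w))) -
    var2 i * Ex (fun w => steinD x (vsum full w)) =
  Ex (fun w => (xi i w * (steinF x (vsum full w) - steinF x (vsum (full :\ i) w)) -
    xi i w ^+ 2 * steinD x (vsum (full :\ i) w)) +
    var2 i * (steinD x (vsum (full :\ i) w) - steinD x (vsum full w))).
  rewrite (ExD LX LY) (ExB LF L2D) (ExZ _ (L1B (LD (full :\ i)) (LD full))) (ExB (LD _) (LD _)).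
  by rewrite ED -/(var2 i); ring.
apply: Ex_norm_le => // [|w]; first exact: L1D.
have iB : i \in full by rewrite inE.
rewrite (vsumD1 w iB); move: (vsum _ w) (xi i w) => v y.
have h1 := steinF_step x0 v y; have h2 := steinD_step x0 v y.
apply: le_trans (ler_normD _ _) _; rewrite /err /= mulrDl; apply: lerD.
  have -> : y * (steinF x (v + y) - steinF x v) - y ^+ 2 * steinD x v =
     y * (steinF x (v + y) - steinF x v - y * steinD x v) by ring.
  have yy : y ^+ 2 = `|y| * `|y| by rewrite -expr2 real_normK ?num_real.
  rewrite normrM yy -[leRHS]mulrA ler_wpM2l //.
by rewrite normrM ger0_norm ?var2_ge0 // ler_wpM2l ?var2_ge0 // distrC.
Qed.

Lemma tail_indicator : Ex (fun w => steinD x (vsum full w)) =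
  Ex (fun w => vsum full w * steinF x (vsum full w)) + (1 - Phi x) -
  Ex (fun w => (x <= vsum full w)%R%:R).
Proof.
have mF := measurable_steinF; have mV := measurable_vsum full.
have L1a : L1 (fun w => vsum full w * steinF x (vsum full w)).
  apply: (L1_mul_bounded (k := 6) (L1_vsum full)).
    by apply: (measurableT_comp mF); exact: mV.
  by move=> w; have /andP[? ?] := steinF_bound x0 (vsum full w); rewrite ger0_norm.
have L1b : L1 (fun w => (x <= vsum full w)%R%:R).
  apply: (@L1_bounded _ _ _ P _ 1) => [|w].
    by apply: measurable_bool_natr; meas.
  by case: (x <= _); rewrite ?normr1 ?normr0.
have L1c := L1D L1a (L1_cst P (1 - Phi x)).
by rewrite /steinD (ExB L1c L1b) (ExD L1a (L1_cst P _)) Ex_cst.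
Qed.

(** Summing [Ex_err_le] over i leaves gam (2 A1 + 5 A2); the factor
    (1 + x) e^(-x^2/2) in A2 is at most 24 (1 + x)^2 (1 - Phi x) by
    [tail_lower_bound], and (1 + x)^2 <= 4 (1 + x^3). *)
Lemma tail_error_small : `|Ex (fun w => (x <= vsum full w)%R%:R) - (1 - Phi x)| <=
  21000 * (1 - Phi x) * (1 + x ^+ 3) * gam * expR (x ^+ 3 * gam).
Proof.
have x0' := x0; have xg := xg_small; have g0 := gam_gt0.
have px := Phi_lt1 x0.
have Fb u : `|steinF x u| <= 6.
  by have /andP[? ?] := steinF_bound x0 u; rewrite ger0_norm.
have -> : Ex (fun w => (x <= vsum full w)%R%:R) - (1 - Phi x) =
   \sum_(i in full) (Ex (fun w => xi i w * (steinF x (vsum full w) - steinF x (vsum (full :\ i) w))) -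
      var2 i * Ex (fun w => steinD x (vsum full w))).
  rewrite sumrB -(stein_identity full measurable_steinF Fb) -mulr_suml.
  rewrite (eq_bigl xpredT); last by move=> i; rewrite inE.
  by rewrite sum_var2 mul1r tail_indicator; ring.
apply: le_trans (ler_norm_sum _ _ _) _.
apply: (@le_trans _ _ (\sum_(i in full) (2 * (A1 + A2) * abs3 i + 2 * gam * A2 * (var2 i + x * abs3 i)))).
  apply: ler_sum => i _; apply: le_trans (stein_error_term i) _.
  by have [] := Ex_err_le i.
rewrite (eq_bigl xpredT); last by move=> i; rewrite inE.
rewrite big_split /= -!mulr_sumr big_split /= -mulr_sumr sum_var2 -/gam.
set E := expR (x ^+ 3 * gam).
have E0 : 0 <= E by exact: expR_ge0.
have A20 : 0 <= A2 by rewrite /A2 !mulr_ge0 ?expR_ge0 ?addr_ge0 ?ler01.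
have A2le : A2 <= 3456 * (1 + x ^+ 3) * (1 - Phi x) * E.
  have -> : A2 = 36 * (1 + x) * (expR (- (x ^+ 2 / 2)) * E).
    by rewrite /A2 /B /E -!expRD; congr (_ * expR _); field.
  have t := tail_lower_bound x0.
  have c1 : 0 <= 36 * (1 + x) by lra.
  have t' := ler_wpM2l c1 (ler_wpM2r E0 t).
  apply: (le_trans t').
  have x3 : (1 + x) ^+ 2 <= 4 * (1 + x ^+ 3).
    have := sqr_ge0 (x - 1); have : 0 <= x * (x - 1) ^+ 2 by rewrite mulr_ge0 ?sqr_ge0.
    nra.
  have pE : 0 <= 864 * (1 - Phi x) * E.
    exact: (mulr_ge0 (mulr_ge0 (ler0n R 864) (ltW px)) E0).
  have := ler_wpM2r pE x3; lra.
have A1E : A1 = 1800 * ((1 + x ^+ 3) * (1 - Phi x) * E) by rewrite /A1 -/E; ring.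
have h : 2 * (A1 + A2) * gam + 2 * gam * A2 * (1 + x * gam) <= gam * (2 * A1 + 5 * A2).
  have gA : 0 <= gam * A2 by rewrite mulr_ge0 // ltW.
  have := ler_wpM2l gA xg; lra.
apply: (le_trans h).
have -> : 21000 * (1 - Phi x) * (1 + x ^+ 3) * gam * E =
  gam * (21000 * ((1 + x ^+ 3) * (1 - Phi x) * E)) by ring.
rewrite ler_wpM2l ?(ltW g0) //.
have Q0 : 0 <= (1 + x ^+ 3) * (1 - Phi x) * E.
  by rewrite !mulr_ge0 ?(ltW px) ?E0 // addr_ge0 ?exprn_ge0.
lra.
Qed.

End Comparison.

(** Markov's inequality for e^(x W), whose expectation is at most
    e^(x^2/2 + x^3 gam). *)
Lemma chernoff_at_x : Ex (fun w => (x <= vsum full w)%R%:R) <=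
  expR (- (x ^+ 2 / 2)) * expR (x ^+ 3 * gam).
Proof.
have x0' := x0; have mV := measurable_vsum full.
have xx : 0 <= x <= x by rewrite x0 lexx.
have [L E] := vsum_mgf full xx.
apply: (@le_trans _ _ (Ex (fun w => expR (- x ^+ 2) * expR (x * vsum full w)))).
  apply: Ex_le => [||w]; last 1 first.
  - rewrite -expRD; have [xw|_] := leP x (vsum full w); last exact: expR_ge0.
    by rewrite mulr1n -[leLHS]expR0 ler_expR; have := ler_wpM2l x0 xw; lra.
  - apply: (@L1_bounded _ _ _ P _ 1) => [|w]; first by apply: measurable_bool_natr; meas.
    by case: (x <= _); rewrite ?normr1 ?normr0.
  - exact: L1Z.
rewrite ExZ //; apply: le_trans (ler_wpM2l (expR_ge0 _) E) _.
by rewrite -!expRD ler_expR; lra.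
Qed.

(** Here (1 + x^3) gam is at least (1 + x)/128, so both tails are separately of
    the order of the right-hand side. *)
Lemma tail_error_large : 1 / 64 < gam \/ 1 / 64 < x * gam ->
  `|Ex (fun w => (x <= vsum full w)%R%:R) - (1 - Phi x)| <=
  3072 * (1 - Phi x) * (1 + x ^+ 3) * gam * expR (x ^+ 3 * gam).
Proof.
move=> large; have x0' := x0; have g0 := gam_ge0.
have p0 := Phi_lt1 x0; have t := tail_lower_bound x0; have c := chernoff_at_x.
have a0 : 0 <= Ex (fun w => (x <= vsum full w)%R%:R).
  by apply: Ex_ge0 => w; exact: ler0n.
have x3 : 0 <= x ^+ 3 by rewrite exprn_ge0.
have E1 : 1 <= expR (x ^+ 3 * gam) by rewrite -[leLHS]expR0 ler_expR mulr_ge0.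
have E0 := le_trans ler01 E1.
have big : 1 + x <= 128 * ((1 + x ^+ 3) * gam).
  have case1 : 1 / 64 < gam -> 1 + x <= 128 * ((1 + x ^+ 3) * gam).
    move=> g1; have : (1 + x ^+ 3) * (1 / 64) <= (1 + x ^+ 3) * gam.
      by rewrite ler_wpM2l ?addr_ge0 // ltW.
    have : x <= 1 + 2 * x ^+ 3 by have [x1|x1] := leP 1 x; [rewrite exprS|]; nra.
    lra.
  case: large => // xg; have [x1|/ltW x1] := leP 1 x; last first.
    apply: case1; apply: lt_le_trans xg _; rewrite ler_piMl //.
  have h : x ^+ 2 * (1 / 64) <= x ^+ 2 * (x * gam) by rewrite ler_wpM2l ?sqr_ge0 // ltW.
  have x2 : x <= x ^+ 2 by nra.
  have : x ^+ 2 * (x * gam) = x ^+ 3 * gam by ring.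
  lra.
set E := expR (x ^+ 3 * gam) in c E1 E0 *.
set a := Ex _ in c a0 *.
set p := 1 - Phi x in p0 t *.
have aE : a <= 24 * (1 + x) * p * E.
  by apply: (le_trans c); rewrite ler_wpM2r.
have pE : p <= 24 * (1 + x) * p * E.
  have h1 : p * 1 <= p * E by rewrite ler_wpM2l // ltW.
  have h2 : 0 <= p * E by rewrite mulr_ge0 // ltW.
  have h3 : 0 <= x * (p * E) by rewrite mulr_ge0.
  lra.
have aux : 24 * (1 + x) * p * E <= 3072 * p * (1 + x ^+ 3) * gam * E.
  have h2 : 0 <= p * E by rewrite mulr_ge0 // ltW.
  have := ler_wpM2r h2 big; lra.
rewrite ler_norml; apply/andP; split; lra.
Qed.

Lemma tail_error : `|Ex (fun w => (x <= vsum full w)%R%:R) - (1 - Phi x)| <=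
  21000 * (1 - Phi x) * (1 + x ^+ 3) * gam * expR (x ^+ 3 * gam).
Proof.
have weaken : 3072 * (1 - Phi x) * (1 + x ^+ 3) * gam * expR (x ^+ 3 * gam) <=
    21000 * (1 - Phi x) * (1 + x ^+ 3) * gam * expR (x ^+ 3 * gam).
  have x3 : 0 <= 1 + x ^+ 3 by rewrite addr_ge0 ?exprn_ge0.
  have Q0 := mulr_ge0 (mulr_ge0 (mulr_ge0 (ltW (Phi_lt1 x0)) x3) gam_ge0) (expR_ge0 (x ^+ 3 * gam)).
  lra.
have [gs|gl] := leP gam (1 / 64).
  have [xg|xg] := leP (x * gam) (1 / 64); first exact: tail_error_small.
  by apply: le_trans (tail_error_large (or_intror xg)) weaken.
exact: le_trans (tail_error_large (or_introl gl)) weaken.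
Qed.

End IndependentSums.

(** * The moderate deviation estimate *)

Theorem proposition4p5 (R : realType) :
  exists C : R,
    forall (d : measure_display) (T : measurableType d) (P : probability T R)
      (n : nat) (xi : 'I_n -> {RV P >-> R}) (tn : R),
    mutually_independent xi ->
    0 < tn ->
    (forall i, ('E_P[xi i] = 0)%E) ->
    (forall i, ('E_P[fun w => expR (tn * `|xi i w|)%R] < +oo)%E) ->
    (\sum_(i < n) 'E_P[fun w => (xi i w ^+ 2)%R] = 1)%E ->
    forall x : R, 0 <= x <= tn ->
    (gamma xi x < +oo)%E ->
    let g := fine (gamma xi x) in
    exists2 theta : R, `|theta| <= C &
      fine (P [set w | x <= \sum_(i < n) xi i w]) / (1 - Phi x) =
        1 + theta * (1 + x ^+ 3) * g * expR (4 * x ^+ 3 * g).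
Proof.
exists 21000 => d T P n xi tn indep _ mean _ var x /andP[x0 _] gfin g.
have mw i : measurable_fun setT (fun w => `|xi i w| ^+ 3 * expR (x * `|xi i w|)).
  by meas.
have e0 i : (0 <= 'E_P[fun w => (`|xi i w| ^+ 3 * expR (x * `|xi i w|))%R])%E.
  by apply: expectation_ge0 => w; rewrite mulr_ge0 ?expR_ge0 ?exprn_ge0.
have Lq i : L1 P (fun w => `|xi i w| ^+ 3 * expR (x * `|xi i w|)).
  apply: (L1_of_expectation (mw i)) => [w|]; first by rewrite mulr_ge0 ?expR_ge0 ?exprn_ge0.
  apply: le_lt_trans gfin; rewrite /gamma (bigD1 i) //= leeDl //.
  by apply: sume_ge0 => j _.
have Lxi i : L1 P (xi i).
  apply: (L1_le _ (L1D (L1_cst P 1) (Lq i))) => // w.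
  have := normr_ge0 (xi i w); move: `|_| => u u0.
  have E1 : 1 <= expR (x * u) by rewrite -[leLHS]expR0 ler_expR mulr_ge0.
  have u3 : u ^+ 3 <= u ^+ 3 * expR (x * u) by rewrite ler_peMr ?exprn_ge0.
  apply: (@le_trans _ _ (1 + u ^+ 3)); last by rewrite lerD2l.
  by have [u1|u1] := leP 1 u; [rewrite exprS|have := exprn_ge0 3 u0]; nra.
have L2 i : L1 P (fun w => xi i w ^+ 2) := L1_xi2 x0 Lq i.
have Exi i : Ex P (xi i) = 0.
  by apply: EFin_inj; rewrite Ex_EFin //; have := mean i; rewrite unlock.
have sv : \sum_i var2 xi i = 1.
  apply: EFin_inj; rewrite -sumEFin; apply: etrans var; apply: eq_bigr => i _.
  by rewrite Ex_EFin // unlock.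
have gE : g = gam xi x.
  rewrite /g /gam; apply: EFin_inj; rewrite fineK; last first.
    by rewrite ge0_fin_numE // sume_ge0.
  rewrite -sumEFin; apply: eq_bigr => i _.
  by rewrite Ex_EFin // unlock.
have g0 : 0 < g by rewrite gE; exact: gam_gt0.
have p0 := Phi_lt1 x0.
have := tail_error indep Lxi Exi x0 Lq sv; rewrite -gE.
have mV := measurable_vsum xi [set: 'I_n].
have mI : measurable [set w | x <= vsum xi [set: 'I_n] w].
  have := measurable_fun_ler (measurable_cst x) mV measurableT.
  by move=> /(_ [set true] I); rewrite setTI.
rewrite (Ex_indicator P mI).2.
have -> : [set w | x <= vsum xi [set: 'I_n] w] = [set w | x <= \sum_(i < n) xi i w].
  have vE w : vsum xi [set: 'I_n] w = \sum_(i < n) xi i w.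
    by apply: eq_bigl => i; rewrite inE.
  by apply/seteqP; split=> w /=; rewrite vE.
set a := fine _; set p := 1 - Phi x in p0 *; move=> err.
have x3 : 0 <= x ^+ 3 by rewrite exprn_ge0.
(* The denominator is positive, so the constant theta is forced. *)
pose N := (1 + x ^+ 3) * g * expR (4 * x ^+ 3 * g).
have N0 : 0 < N by rewrite /N mulr_gt0 ?expR_gt0 // mulr_gt0 //; lra.
exists ((a / p - 1) / N); last first.
  have -> : (a / p - 1) / N * (1 + x ^+ 3) * g * expR (4 * x ^+ 3 * g) =
      (a / p - 1) / N * N by rewrite /N; ring.
  by rewrite divfK ?gt_eqF // addrC subrK.
rewrite normrM normfV (gtr0_norm N0) ler_pdivrMr //.
have -> : a / p - 1 = (a - p) / p by rewrite mulrBl divff // gt_eqF.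
rewrite normrM normfV (gtr0_norm p0) ler_pdivrMr //.
apply: (le_trans err).
have Q0 : 0 <= 21000 * p * (1 + x ^+ 3) * g.
  by apply: mulr_ge0 (ltW g0); apply: mulr_ge0; [exact: (mulr_ge0 (ler0n R 21000) (ltW p0))|lra].
have -> : 21000 * N * p = 21000 * p * (1 + x ^+ 3) * g * expR (4 * x ^+ 3 * g).
  by rewrite /N; ring.
apply: ler_wpM2l => //; rewrite ler_expR.
by rewrite -mulrA ler_peMl ?mulr_ge0 ?(ltW g0) // ler1n.
Qed.
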